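(* Let $(X,d)$ be a discrete metric space of bounded geometry, with Roe algebra $C^*(X)$. Then: (1) For every rank distribution $\mathcal{R}$ on $X$ and every non-zero ideal $I$ in $C^*(X)$ with $\mathcal{R}(I)=\mathcal{R}$, we have $I(\mathcal{R})\subseteq I\subseteq \tilde{I}(\mathcal{R})$, where $I(\mathcal{R})$ is the geometric ideal and $\tilde I(\mathcal{R})$ the ghostly ideal associated to $\mathcal{R}$. (2) For every non-empty invariant open subset $U\subseteq \beta X$ and every rank distribution $\mathcal{R}$ on $X$ with $U_{\mathcal{R}}=U$, we have $\mathcal{R}_{\min}(U)\subseteq \mathcal{R}\subseteq \mathcal{R}_{\max}(U)$. Moreover, $\mathcal{R}_{\min}(U)=\mathcal{R}_{\max}(U)$ if and only if $U=X$.
   Context: Bounded geometry: for every $r>0$, $\sup_{x\in X}\sharp B(x,r)<\infty$. A subset $E\subseteq X\times X$ is an entourage if $\sup_{(x,y)\in E}d(x,y)<\infty$. Put $E_r=\{(x,y): d(x,y)\le r\}$. Roe algebra: Fix a separable infinite-dimensional Hilbert space $\mathcal{H}$. Write $T\in\mathfrak{B}(\ell^2(X)\otimes\mathcal{H})$ as a matrix $[T(x,y)]_{x,y\in X}$ with $T(x,y)\in\mathfrak{B}(\mathcal{H})$. $T$ has finite propagation if $\{(x,y):T(x,y)\ne0\}$ is an entourage, and is locally compact if every $T(x,y)$ is compact. $\mathbb{C}[X]$ is the $*$-algebra of locally compact finite propagation operators and $C^*(X)$ is its norm closure. Ideals in $C^*(X)$ are closed and two-sided. Rank distributions: A rank function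 is a function $\alpha:X\times X\to\mathbb{Z}_{\ge0}$ whose support $\mathrm{supp}(\alpha)=\{(x,y):\alpha(x,y)\neq 0\}$ is an entourage. For an entourage $E$, $(E\cdot\alpha)(x,y)=\sum_{z}\chi_E(x,z)\alpha(z,y)$ and $(\alpha\cdot E)(x,y)=\sum_z\alpha(x,z)\chi_E(z,y)$; $\alpha^t(x,y)=\alpha(y,x)$; sums and the order $\le$ are pointwise. A rank distribution on $X$ is a collection $\mathcal{R}$ of rank functions such that: (i) if $\alpha,\beta\in\mathcal{R}$ and $E$ is an entourage then $\alpha+\beta,\alpha^t,E\cdot\alpha,\alpha\cdot E\in\mathcal{R}$; (ii) every rank function with finite support is in $\mathcal{R}$; (iii) if $\alpha$ is a rank function with $\alpha\le\beta$ for some $\beta\in\mathcal{R}$ then $\alpha\in\mathcal{R}$. Truncations: a compact operator $S$ on $\mathcal{H}$ has a singular value decomposition $S=\sum_i\lambda_i(S)\,u_i\otimes v_i$, with $(u\otimes v)x=\langle x,v\rangle u$, and for $\varepsilon>0$ its $\varepsilon$-truncation is $S_\varepsilon=\sum_{i:\lambda_i(S)\ge\varepsilon}\lambda_i(S)u_i\otimes v_i$. For $T\in C^*(X)$, $T_\varepsilon$ is the operator with entries $T_\varepsilon(x,y)=T(x,y)_\varepsilon$. If all entries of $T$ have finite rank, $\mathrm{RANK}(T)(x,y)=\mathrm{rank}(T(x,y))$. For a non-zero ideal $I$ in $C^*(X)$, $\mathcal{R}(I):=\{\mathrm{RANK}(T_\varepsilon):T\in I,\varepsilon>0\}$, which is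 a rank distribution. Ideals associated to $\mathcal{R}$: $I(\mathcal{R})$ is the norm closure of $C_{\mathcal{R}}=\{T\in\mathbb{C}[X]: T(x,y)\text{ has finite rank for all }x,y,\ \mathrm{RANK}(T)\in\mathcal{R}\}$; $\tilde I(\mathcal{R})=\{T\in C^*(X):\mathrm{RANK}(T_\varepsilon)\in\mathcal{R}\text{ for all }\varepsilon>0\}$. Invariant subsets: $\beta X$ is the Stone–Čech compactification of the discrete set $X$ (so $X\subseteq\beta X$). The coarse groupoid is $G(X)=\bigcup_{r\ge0}\overline{E_r}^{\beta(X\times X)}\subseteq\beta(X\times X)$; the maps $r(x,y)=x$, $s(x,y)=y$ on $X\times X$ extend continuously to $r,s:G(X)\to\beta X$. The map $(r,s):G(X)\to\beta X\times\beta X$ is injective, and $G(X)$ carries the groupoid structure induced from the pair groupoid. $U\subseteq\beta X$ is invariant if every $\gamma\in G(X)$ with $s(\gamma)\in U$ also has $r(\gamma)\in U$. For a rank distribution $\mathcal{R}$, $U_{\mathcal{R}}:=\bigcup_{\alpha\in\mathcal{R}}\overline{r(\mathrm{supp}(\alpha))}$ (closures in $\beta X$), a non-empty invariant open set. For a non-empty invariant open $U\subseteq\beta X$, $\mathcal{R}_{\max}(U)$ is the set of all rank functions $\alpha$ with $\overline{r(\mathrm{supp}(\alpha))}\subseteq U$, and $\mathcal{R}_{\min}(U)$ is the set of all bounded such rank functions. *)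

(* Defs.v *)
From HB Require Import structures.
From mathcomp Require Import all_boot all_order all_algebra sesquilinear.
From mathcomp Require Import complex ring.
From mathcomp Require Import all_classical all_reals all_analysis.

Set Implicit Arguments.
Unset Strict Implicit.
Unset Printing Implicit Defensive.

Import Order.TTheory GRing.Theory Num.Theory.
Import numFieldNormedType.Exports.

Local Open Scope classical_set_scope.
Local Open Scope ring_scope.
Local Open Scope complex_scope.

(** * Coarse geometry and rank distributions *)

Section Coarse.
Context {R : realType} {X : metricType R}.

Definition bounded_geometry : Prop :=
  forall r : R, 0 < r ->
    exists N : nat, forall x : X, ([set y | mdist x y <= r] #<= `I_N)%card.

(** "Controlled" sets are the coarse entourages; the library's [entourage]
    refers to the uniform structure. *)
Definition controlled (E : set (X * X)) : Prop :=
  exists r : R, forall x y, E (x, y) -> mdist x y <= r.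

Definition E_ (r : R) : set (X * X) := [set p | mdist p.1 p.2 <= r].

Implicit Types (a b : X -> X -> nat) (E : set (X * X)).

Definition supp a : set (X * X) := [set p | a p.1 p.2 != 0%N].

Definition rank_function a : Prop := controlled (supp a).

Definition chi E (p : X * X) : nat := `[< E p >].

(** The sums below have finitely many non-zero terms when X has bounded
    geometry (and [\big_(_ \in _)] ranges over those terms). *)
Definition E_mull E a (x y : X) : nat :=
  \big[addn/0%N]_(z \in [set: X]) (chi E (x, z) * a z y)%N.

Definition E_mulr a E (x y : X) : nat :=
  \big[addn/0%N]_(z \in [set: X]) (a x z * chi E (z, y))%N.

Record rank_distribution (RD : set (X -> X -> nat)) : Prop := {
  rd_rank : forall a, RD a -> rank_function a ;
  rd_add : forall a b, RD a -> RD b -> RD (fun x y => a x y + b x y)%N ;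
  rd_tr : forall a, RD a -> RD (fun x y => a y x) ;
  rd_lact : forall a E, RD a -> controlled E -> RD (E_mull E a) ;
  rd_ract : forall a E, RD a -> controlled E -> RD (E_mulr a E) ;
  rd_fin : forall a, rank_function a -> finite_set (supp a) -> RD a ;
  rd_le : forall a b, rank_function a -> RD b ->
    (forall x y, a x y <= b x y)%N -> RD a }.

End Coarse.
Arguments bounded_geometry {R} X.

(** * Operators on a Hilbert space

    A Hilbert space is a complete normed module [H] over [R[i]] whose norm comes
    from an inner product [dot], linear in its first argument. *)

Section Hilbert.
Context {R : realType} {H : completeNormedModType R[i]}.
Implicit Types (S : H -> H).

(** The norm of [H] takes its values in [R[i]]. *)
Definition hnorm (h : H) : R := complex.Re `|h|.

Definition separable_space : Prop := exists A : set H, countable A /\ dense A.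

Definition lincomb n (e : 'I_n -> H) : set H :=
  [set \sum_(i < n) c i *: e i | c in [set: 'I_n -> R[i]]].

Definition lin_indep n (e : 'I_n -> H) : Prop :=
  forall c : 'I_n -> R[i], \sum_(i < n) c i *: e i = 0 -> forall i, c i = 0.

Definition infinite_dim : Prop :=
  forall n (e : 'I_n -> H), lincomb e <> [set: H].

Definition compact_op S : Prop :=
  linear S /\ precompact (S @` [set h | `|h| <= 1]).

Definition has_rank S (n : nat) : Prop :=
  exists e : 'I_n -> H, lin_indep e /\ range S = lincomb e.

Definition finite_rank S : Prop := exists n, has_rank S n.

Definition op_rank S : nat := xget 0%N [set n | has_rank S n].

Variable dot : {dot H for (@Num.conj R[i])}.

Definition orthonormal_seq (u : nat -> H) : Prop :=
  forall i j, dot (u i) (u j) = (i == j)%:R.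

(** [S = \sum_i lam_i u_i (x) v_i] where [(u (x) v) h = dot h v *: u]. The index
    set is always [nat]: in infinite dimension the singular vectors of a finite
    rank operator extend to orthonormal sequences, with [lam_i = 0]. Since
    [lam] tends to 0, the pointwise convergence required here is convergence
    in operator norm. *)
Record is_svd S (lam : nat -> R) (u v : nat -> H) : Prop := {
  svd_orthol : orthonormal_seq u ;
  svd_orthor : orthonormal_seq v ;
  svd_ge0 : forall i, 0 <= lam i ;
  svd_noninc : forall i j, (i <= j)%N -> lam j <= lam i ;
  svd_cvg0 : lam @ \oo --> (0 : R) ;
  svd_sum : forall h, (fun n => \sum_(i < n) (lam i)%:C *: (dot h (v i) *: u i))
                        @ \oo --> S h }.

Definition is_truncation (eps : R) S (S' : H -> H) : Prop :=
  exists lam u v, is_svd S lam u v /\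
    forall h, S' h = \sum_(i \in [set i | eps <= lam i])
                       ((lam i)%:C *: (dot h (v i) *: u i)).

(** The truncation does not depend on the singular value decomposition; the
    default value only concerns operators that have none. *)
Definition eps_trunc (eps : R) S : H -> H := xget 0 [set S' | is_truncation eps S S'].

End Hilbert.
Arguments separable_space {R} H.
Arguments infinite_dim {R} H.

(** * The Hilbert space l^2(X) (x) H, as square-summable families *)

Section L2.
Context {R : realType} {X : choiceType} {H : completeNormedModType R[i]}.

Definition sqsum (f : X -> H) : \bar R :=
  \esum_(x in [set: X]) ((hnorm (f x)) ^+ 2)%:E.

Definition l2_pred : {pred X -> H} := fun f => `[< (sqsum f < +oo)%E >].

Lemma hnorm_ge0 (h : H) : 0 <= hnorm h.
Proof.
rewrite /hnorm; have := normr_ge0 h.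
by case: `|h| => a b; rewrite lecE => /andP[].
Qed.

Lemma hnormE (h : H) : (hnorm h)%:C = `|h|.
Proof.
rewrite /hnorm; have := normr_ge0 h; case: `|h| => a b.
by rewrite lecE /= => /andP[/eqP-> _].
Qed.

Lemma hnormD (h k : H) : hnorm (h + k) <= hnorm h + hnorm k.
Proof.
have := ler_normD h k; rewrite -!hnormE -rmorphD /=.
by rewrite lecR.
Qed.

Lemma hnormZ (c : R[i]) (h : H) : hnorm (c *: h) = complex.Re `|c| * hnorm h.
Proof.
rewrite {1}/hnorm normrZ -hnormE; have := normr_ge0 c.
by case: `|c| => a b /=; rewrite mulr0 subr0.
Qed.

Lemma hnorm0 : hnorm (0 : H) = 0.
Proof. by rewrite /hnorm normr0. Qed.

Lemma l2_submod : submod_closed l2_pred.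
Proof.
split.
  apply/asboolP; rewrite /sqsum esum1 ?ltry// => x _.
  by rewrite hnorm0 expr0n.
move=> c f g /asboolP fl /asboolP gl; apply/asboolP.
pose k := 2 * (complex.Re `|c|) ^+ 2.
have k0 : 0 <= k by rewrite mulr_ge0// sqr_ge0.
have sq0 (h : X -> H) x : (0 <= ((hnorm (h x)) ^+ 2)%:E)%E by rewrite lee_fin sqr_ge0.
have s0 (h : X -> H) : (0 <= sqsum h)%E by apply: esum_ge0 => x _; exact: sq0.
apply: (@le_lt_trans _ _ (k%:E * sqsum f + 2%:E * sqsum g)%E); last first.
  by apply: lte_add_pinfty; rewrite lte_mul_pinfty// ?lee_fin ?fin_numE.
apply: ge_ereal_sup => _ [A [finA _] <-].
apply: (@le_trans _ _ (\sum_(x \in A) (k%:E * ((hnorm (f x)) ^+ 2)%:E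
                        + 2%:E * ((hnorm (g x)) ^+ 2)%:E))%E).
  apply: lee_fsum => // x Ax; rewrite -!EFinM -EFinD lee_fin.
  have h1 : hnorm (c *: f x + g x) <= complex.Re `|c| * hnorm (f x) + hnorm (g x).
    by rewrite -hnormZ; exact: hnormD.
  apply: (le_trans (lerXn2r 2 _ _ h1)); rewrite ?nnegrE ?hnorm_ge0//.
    by rewrite (le_trans (hnorm_ge0 _) h1).
  rewrite /k -mulrA -exprMn; set a := (_ * hnorm (f x)); set b := hnorm (g x).
  rewrite -subr_ge0 (_ : _ - _ = (a - b) ^+ 2) ?sqr_ge0//.
  rewrite sqrrD sqrrB !mulr2n !mulrDl !mul1r !opprD.
  by rewrite -!addrA; ring.
rewrite fsbig_split//=; apply: leeD.
  rewrite -ge0_mule_fsumr//; apply: lee_wpmul2l; first by rewrite lee_fin.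
  by apply: ereal_sup_ubound; exists A.
rewrite -ge0_mule_fsumr//; apply: lee_wpmul2l; first by rewrite lee_fin.
by apply: ereal_sup_ubound; exists A.
Qed.

HB.instance Definition _ :=
  GRing.isSubmodClosed.Build R[i] (X -> H) l2_pred l2_submod.

End L2.

Record l2 {R : realType} (X : choiceType) (H : completeNormedModType R[i]) :=
  L2 { l2val :> X -> H ; _ : l2val \in @l2_pred R X H }.

Section L2Type.
Context {R : realType} {X : choiceType} {H : completeNormedModType R[i]}.

HB.instance Definition _ := [isSub for @l2val R X H].
HB.instance Definition _ := [Choice of l2 X H by <:].
HB.instance Definition _ := [SubChoice_isSubLmodule of l2 X H by <:].

Definition l2norm (f : l2 X H) : R := Num.sqrt (fine (sqsum f)).

Definition delta_fun (y : X) (h : H) : X -> H := fun x => if x == y then h else 0.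

Lemma delta_l2 y h : delta_fun y h \in @l2_pred R X H.
Proof.
apply/asboolP; rewrite /sqsum (esumID [set y]); last first.
  by move=> x _; rewrite lee_fin sqr_ge0.
rewrite setTI esum_set1; last by rewrite lee_fin sqr_ge0.
rewrite esum1 ?adde0 ?ltry// => x [_ /= /eqP xy].
by rewrite /delta_fun (negbTE xy) hnorm0 expr0n.
Qed.

(** The elementary tensor of the basis vector at [y] and [h]. *)
Definition l2delta (y : X) (h : H) : l2 X H := L2 (delta_l2 y h).

Implicit Types (T : l2 X H -> l2 X H) (A : set (l2 X H -> l2 X H)).

Definition bounded_op T : Prop :=
  linear T /\ exists M : R, forall f, l2norm (T f) <= M * l2norm f.

Definition opnorm T : R := sup [set l2norm (T f) | f in [set f | l2norm f <= 1]].

Definition opclosure A : set (l2 X H -> l2 X H) :=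
  [set T | bounded_op T /\
     forall e : R, 0 < e -> exists S, A S /\ opnorm (T - S) < e].

Definition entry T (x y : X) : H -> H := fun h => T (l2delta y h) x.

Definition opsupp T : set (X * X) := [set p | entry T p.1 p.2 <> 0].

End L2Type.

(** * The Roe algebra, its ideals and rank distributions *)

Section Roe.
Context {R : realType} {X : metricType R} {H : completeNormedModType R[i]}.
Implicit Types (T : l2 X H -> l2 X H) (I : set (l2 X H -> l2 X H)).
Implicit Types (RD : set (X -> X -> nat)).

Definition finite_propagation T : Prop := controlled (opsupp T).

Definition locally_compact_op T : Prop := forall x y, compact_op (entry T x y).

Definition algRoe : set (l2 X H -> l2 X H) :=
  [set T | [/\ bounded_op T, locally_compact_op T & finite_propagation T]].

Definition Roe : set (l2 X H -> l2 X H) := opclosure algRoe.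

Record roe_ideal I : Prop := {
  ri_sub : I `<=` Roe ;
  ri_0 : I 0 ;
  ri_add : forall S T, I S -> I T -> I (S + T) ;
  ri_scale : forall (c : R[i]) T, I T -> I (c *: T) ;
  ri_mull : forall S T, Roe S -> I T -> I (S \o T) ;
  ri_mulr : forall S T, Roe S -> I T -> I (T \o S) ;
  ri_closed : opclosure I `<=` I }.

Definition nonzero_ideal I : Prop := exists2 T, I T & T <> 0.

(** [RANK] only depends on matrix entries, and is defined on matrices; the
    operator [T_eps] is represented by its matrix [trunc_mx dot eps T]. *)
Definition RANK (M : X -> X -> H -> H) : X -> X -> nat := fun x y => op_rank (M x y).

Definition geometric_ideal RD : set (l2 X H -> l2 X H) :=
  opclosure [set T | [/\ algRoe T, forall x y, finite_rank (entry T x y)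
                        & RD (RANK (entry T))]].

Variable dot : {dot H for (@Num.conj R[i])}.

Definition trunc_mx (eps : R) T : X -> X -> H -> H :=
  fun x y => eps_trunc dot eps (entry T x y).

Definition rank_distr_of I : set (X -> X -> nat) :=
  [set a | exists T eps, [/\ I T, 0 < eps & a = RANK (trunc_mx eps T)]].

Definition ghostly_ideal RD : set (l2 X H -> l2 X H) :=
  [set T | Roe T /\ forall eps : R, 0 < eps -> RD (RANK (trunc_mx eps T))].

End Roe.

(** * The Stone-Cech compactification of a discrete set, as its space of
    ultrafilters *)

Record beta (T : Type) := Beta {
  ultra :> set T -> Prop ;
  ultraP : UltraFilter ultra }.

HB.instance Definition _ (T : Type) := gen_eqMixin (beta T).
HB.instance Definition _ (T : Type) := gen_choiceMixin (beta T).

Section Beta.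
Context {T : Type}.
Implicit Types (F G : beta T) (A : set T).

Definition bbase A : set (beta T) := [set F : beta T | F A].

#[global] Instance beta_ultra F : UltraFilter F := ultraP F.

Lemma beta_inj F G : (forall A, F A -> G A) -> F = G.
Proof.
case: F G => F FP [G GP] /= FG; have e : G = F by exact: max_filter.
by subst G; congr Beta; exact: Prop_irrelevance.
Qed.

Lemma bbase_cover : \bigcup_(A in [set: set T]) bbase A = setT.
Proof. by apply/seteqP; split => // F _; exists setT => //; exact: filterT. Qed.

Lemma bbase_join A B F : [set: set T] A -> [set: set T] B ->
  bbase A F -> bbase B F ->
  exists k, [/\ [set: set T] k, bbase k F & bbase k `<=` bbase A `&` bbase B].
Proof.
move=> _ _ FA FB; exists (A `&` B); split => //; first exact: filterI.
by move=> G GAB; split; apply: filterS GAB => x [].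
Qed.

HB.instance Definition _ :=
  isBaseTopological.Build (beta T) bbase_cover bbase_join.

Definition principal (x : T) : beta T := Beta (principal_filter_ultra x).

End Beta.

Lemma fmap_ultra (T U : Type) (f : T -> U) (F : set_system T) :
  UltraFilter F -> UltraFilter (f @ F).
Proof.
move=> FU; split; first exact: fmap_proper_filter.
move=> G GP FG; apply/seteqP; split => // A GA.
have [//|FnA] := in_ultra_setVsetC (f @^-1` A) FU.
have /FG GnA : (f @ F) (~` A) by [].
by have /filter_ex[x []] : G (A `&` ~` A) by exact: filterI.
Qed.

(** The continuous extension of [f] (see [beta_map_continuous] and
    [beta_map_principal]). *)
Definition beta_map {T U : Type} (f : T -> U) (F : beta T) : beta U :=
  Beta (fmap_ultra f (ultraP F)).

Section BetaTheory.
Context {T : Type}.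

Lemma open_bbase (A : set T) : open (bbase A).
Proof. by exists [set A] => //; rewrite bigcup_set1. Qed.

Lemma bbaseC (A : set T) : bbase (~` A) = ~` bbase A.
Proof.
apply/seteqP; split=> F /= FA.
  by move=> FA'; have /filter_ex[x []] : F (~` A `&` A) by exact: filterI.
by have [] := in_ultra_setVsetC A (ultraP F).
Qed.

Lemma closed_bbase (A : set T) : closed (bbase A).
Proof. by rewrite -(setCK A) bbaseC closedC; exact: open_bbase. Qed.

Lemma nbhs_betaP (F : beta T) (V : set (beta T)) :
  nbhs F V <-> exists2 A, F A & bbase A `<=` V.
Proof.
rewrite nbhsE; split=> [[W [[D _ <-] [A DA FA]] WV]|[A FA AV]].
  by exists A => // G GA; apply: WV; exists A.
by exists (bbase A) => //; split => //; exact: open_bbase.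
Qed.

Lemma beta_hausdorff : hausdorff_space (beta T).
Proof.
move=> F G FG; apply/esym/beta_inj => A GA; apply: contrapT => FnA.
have FA : F (~` A) by case: (in_ultra_setVsetC A (ultraP F)).
have [||K [KnA KA]] := FG (bbase (~` A)) (bbase A).
- by apply/nbhs_betaP; exists (~` A).
- by apply/nbhs_betaP; exists A.
by move: KnA; rewrite bbaseC.
Qed.

Lemma beta_compact : compact [set: beta T].
Proof.
rewrite compact_ultra => FF FFU _.
have FU : UltraFilter [set A : set T | FF (bbase A)].
  split.
    apply: Build_ProperFilter_ex.
      move=> A FA; have [G GA] : bbase A !=set0 by exact: (@filter_ex _ FF).
      exact: (@filter_ex _ G).
    split => /=.
    - by apply: (@filterS _ FF _ setT _ _ filterT) => G _; exact: filterT.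
    - move=> A B FA FB; apply: (@filterS _ FF _ _ _ _ (@filterI _ FF _ _ _ FA FB)).
      by move=> G []; exact: filterI.
    - by move=> A B AB; apply: (@filterS _ FF) => G; exact: filterS.
  move=> G GP FG; apply/seteqP; split => // A GA /=.
  have [//|FnA] := in_ultra_setVsetC (bbase A) FFU.
  have /FG GnA : FF (bbase (~` A)) by rewrite bbaseC.
  by have /filter_ex[x []] : G (A `&` ~` A) by exact: filterI.
exists (Beta FU); split => // V /nbhs_betaP[A FA AV].
exact: (@filterS _ FF _ (bbase A)).
Qed.

Lemma dense_principal : dense (range (@principal T)).
Proof.
move=> W [F WF] oW.
have /nbhs_betaP[A /filter_ex[x Ax] AW] : nbhs F W by exact: open_nbhs_nbhs.
by exists (principal x); split; [apply: AW; apply/principal_filterP|exists x].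
Qed.

End BetaTheory.

Lemma beta_map_continuous (T U : Type) (f : T -> U) : continuous (beta_map f).
Proof.
move=> F V FV; have [A FA AV] := (nbhs_betaP _ _).1 FV; apply: (nbhs_betaP _ _).2.
by exists (f @^-1` A) => // G GA; exact: AV.
Qed.

Lemma beta_map_principal (T U : Type) (f : T -> U) (x : T) :
  beta_map f (principal x) = principal (f x).
Proof.
apply: beta_inj => A /= /principal_filterP Ax.
exact/principal_filterP.
Qed.

Lemma cvg_principal (T : Type) (F : beta T) : principal @ (ultra F : set_system T) --> F.
Proof.
move=> V FV; have [A FA AV] := (nbhs_betaP _ _).1 FV.
apply: (@filterS _ (ultra F) _ A) FA => x Ax; exact/AV/principal_filterP.
Qed.

Lemma beta_universal (T : Type) (K : topologicalType) (f : T -> K) :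
  hausdorff_space K -> compact [set: K] ->
  exists! g : beta T -> K, continuous g /\ forall x, g (principal x) = f x.
Proof.
move=> hK cK.
have limP (F : beta T) : exists p : K, f @ (ultra F : set_system T) --> p.
  have FU := fmap_ultra f (ultraP F).
  by move: cK; rewrite compact_ultra => /(_ _ FU filterT) => -[p [_ Fp]]; exists p.
have /choice[g gP] := limP.
have uniq (F : beta T) (p : K) : f @ (ultra F : set_system T) --> p -> g F = p.
  by have FU := fmap_ultra f (ultraP F); apply: cvg_unique (gP F).
exists g; split; [split|].
- move=> F V /(compact_regular hK cK filterT)[W /gP FW WV].
  apply: (nbhs_betaP _ _).2; exists (f @^-1` W) => // G GW; apply: WV => B /gP GB.
  have /filter_ex[x [? ?]] : G (f @^-1` W `&` f @^-1` B) by exact: filterI.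
  by exists (f x).
- move=> x; apply: uniq => V /nbhs_singleton Vx.
  exact/principal_filterP.
move=> h [hc hf]; apply/funext => F; apply: uniq.
have -> : f = h \o principal by apply/funext => x; rewrite /= hf.
by move=> V /hc /cvg_principal.
Qed.

(** * The coarse groupoid and its invariant open subsets *)

Section Groupoid.
Context {R : realType} {X : metricType R}.
Implicit Types (U : set (beta X)) (RD : set (X -> X -> nat)).

(** The groupoid structure of [G] enters only through its range and source
    maps. *)
Definition coarse_groupoid : set (beta (X * X)) :=
  \bigcup_(r in [set r : R | 0 <= r]) closure (principal @` (E_ r : set (X * X))).

Definition grange : beta (X * X) -> beta X := beta_map fst.
Definition gsource : beta (X * X) -> beta X := beta_map snd.

Definition invariant_set U : Prop :=
  forall g, coarse_groupoid g -> U (gsource g) -> U (grange g).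

Definition range_closure (a : X -> X -> nat) : set (beta X) :=
  closure (principal @` (fst @` supp a)).

Definition open_of RD : set (beta X) := \bigcup_(a in RD) range_closure a.

Definition Rmax U : set (X -> X -> nat) :=
  [set a | rank_function a /\ range_closure a `<=` U].

Definition Rmin U : set (X -> X -> nat) :=
  [set a | Rmax U a /\ exists N, forall x y, (a x y <= N)%N].

End Groupoid.

(* Main.v *)
From HB Require Import structures.
Require Import Defs.
From mathcomp Require Import all_boot all_order all_algebra sesquilinear.
From mathcomp Require Import finmap complex ring lra.
From mathcomp Require Import all_classical all_reals all_analysis.

Set Implicit Arguments.
Unset Strict Implicit.
Unset Printing Implicit Defensive.

Import Order.TTheory GRing.Theory Num.Theory.
Import numFieldNormedType.Exports.

Local Open Scope classical_set_scope.
Local Open Scope ring_scope.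
Local Open Scope complex_scope.

(** The inclusion of [I] in the ghostly ideal is immediate from the definition of
    the rank distribution of [I].

    The inclusion of the geometric ideal rests on one construction. Let [T] be
    a finite propagation operator with finite rank entries such that the rank
    of [T(x,y)] is the rank of [S(x,y)] truncated at [eps], with [S] in [I]. At
    least rank [T(x,y)] singular values of [S(x,y)] are then [>= eps], so
    [T(x,y) = A(x,y) S(x,y) B(x,y)] with finite rank [A(x,y)], [B(x,y)] whose
    norms are bounded by [1/eps] and by the norm of [T] ([rank_factor]). To
    turn these local factors into elements of the Roe algebra, colour the points
    of [X] with finitely many colours so that points at distance at most a large
    [L] have different colours ([coloring]; this is where bounded geometry
    enters). For a pair [c] of colours, a point [x] has at most one partner [y]
    in its ball of radius [r], the propagation of [T], such that [(x,y)] has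
    colours [c], so [A(x,y)] and [B(x,y)] define block-diagonal operators [A_c]
    and [B_c], and [sum_c A_c S B_c] belongs to [I].

    This sum is close to [T] ([ideal_approx]). Let [S'] have finite propagation
    and be [d]-close to [S]. If [L] is large compared to [r] and to the
    propagation of [S'], the operator [sum_c A_c S' B_c] has the entries
    [A(x,y) S'(x,y) B(x,y)] when [(x,y)] is in the [r]-neighbourhood of the
    diagonal and no others; so it differs from [T] by an operator of propagation
    [r] with entries of size [O(d)], to which Schur's test applies ([schur_test]).
    The remaining [sum_c A_c (S - S') B_c] is [O(d)] as well. In both estimates
    the constant depends on [r] but not on the number of colours, which grows
    as [d] tends to 0 ([opbound_sum_diag]).

    On the side of the Stone-Cech compactification, the closure of a set of
    principal ultrafilters is the clopen set of the ultrafilters that contain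
    it. If such a clopen set lies in the open set of a rank distribution, then by
    compactness and closure under sums it is covered by a single rank function
    of the distribution ([rank_cover]); a bounded rank function is then
    dominated by a multiple of a translate of that one ([Rmin_sub]). Finally, if
    [U] consists of the principal ultrafilters, every set whose clopen set lies in
    [U] is finite; if [U] contains another ultrafilter, an infinite set has its
    clopen set in [U], and it carries an unbounded rank function on the diagonal
    ([Rmin_eq_Rmax]). *)

(** * Finite rank operators on a Hilbert space *)

(** Operators are bare functions together with a proof of linearity; the lemmas
    on linear maps apply to the packed form. *)
Lemma linear_pack (K : pzRingType) (U V : lmodType K) (f : U -> V) :
  linear f -> exists g : {linear U -> V}, f = g.
Proof.
move=> lf.
pose m := GRing.isLinear.Build K U V *:%R f lf.
pose g : {linear U -> V} := HB.pack f m.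
by exists g.
Qed.

Section Hilbert.
Context {R : realType} {H : completeNormedModType R[i]}.
Variable dot : {dot H for (@Num.conj R[i])}.
Hypothesis dot_norm : forall h : H, `|h| ^+ 2 = dot h h.
Implicit Types (S : H -> H) (a u v w : nat -> H) (c : nat -> R[i]).

Definition orthonormal_upto (m : nat) (a : nat -> H) : Prop :=
  forall i j, (i < m)%N -> (j < m)%N -> dot (a i) (a j) = (i == j)%:R.

Lemma dot_sumr (I : Type) (r : seq I) (P : pred I) h (E : I -> H) :
  dot h (\sum_(i <- r | P i) E i) = \sum_(i <- r | P i) dot h (E i).
Proof. exact: (raddf_sum (dot h)). Qed.

Lemma dot_lincomb m a c (i : 'I_m) : orthonormal_upto m a ->
  dot (\sum_(j < m) c j *: a j) (a i) = c i.
Proof.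
move=> oa; rewrite linear_sumlz (bigD1 i)//= big1 => [|j ji].
  by rewrite linearZl_LR/= oa// eqxx mulr1 addr0.
by rewrite linearZl_LR/= oa// -val_eqE/= in ji *; rewrite (negbTE ji) mulr0.
Qed.

Lemma norm_lincomb m a c : orthonormal_upto m a ->
  `|\sum_(j < m) c j *: a j| ^+ 2 = \sum_(j < m) `|c j| ^+ 2.
Proof.
move=> oa; rewrite dot_norm {1}dot_sumr; apply: eq_bigr => i _.
by rewrite linearZr_LR/= dot_lincomb// normCKC.
Qed.

(** The orthogonal projection onto the span of [a 0, ..., a m.-1], when these
    are orthonormal. *)
Definition proj m a (h : H) : H := \sum_(i < m) dot h (a i) *: a i.

Lemma projP m a : linear (proj m a).
Proof.
move=> c h k; rewrite /proj scaler_sumr -big_split/=; apply: eq_bigr => i _.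
by rewrite linearDl/= linearZl_LR/= scalerDl scalerA.
Qed.

Lemma proj_lincomb m a c : orthonormal_upto m a ->
  proj m a (\sum_(j < m) c j *: a j) = \sum_(j < m) c j *: a j.
Proof. by move=> oa; apply: eq_bigr => i _; rewrite dot_lincomb. Qed.

Lemma dot_sub_proj m a h (i : 'I_m) : orthonormal_upto m a ->
  dot (h - proj m a h) (a i) = 0.
Proof.
move=> oa; rewrite linearBl/= (dot_lincomb (fun j => dot h (a j)))//.
by rewrite subrr.
Qed.

Lemma dot_sub_projr m a h c : orthonormal_upto m a ->
  dot (h - proj m a h) (\sum_(j < m) c j *: a j) = 0.
Proof.
move=> oa; rewrite dot_sumr big1// => i _.
by rewrite linearZr_LR/= dot_sub_proj ?mulr0.
Qed.

(** Pythagoras for [h = (h - proj m a h) + proj m a h]. *)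
Lemma bessel m a h : orthonormal_upto m a ->
  \sum_(i < m) `|dot h (a i)| ^+ 2 <= `|h| ^+ 2.
Proof.
move=> oa; rewrite -(@norm_lincomb m a (fun i => dot h (a i)))//.
rewrite -/(proj m a h) -[in leRHS](subrK (proj m a h) h).
set k := h - _; set p := proj m a h.
have kp : dot k p = 0 by exact: (dot_sub_projr h (fun i => dot h (a i))).
have pk : dot p k = 0 by rewrite hermC/= expr0 mul1r kp rmorph0.
rewrite [leRHS]dot_norm linearDl/= (linearD (dot k))/= (linearD (dot p))/= kp pk addr0 add0r.
by rewrite -!dot_norm lerDr exprn_ge0.
Qed.

(** A vector [e i] in the span of the previous ones contributes no new [a j],
    whence the inequality [m <= k]. *)
Lemma gram_schmidt k (e : 'I_k -> H) : exists m a,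
  [/\ (m <= k)%N, orthonormal_upto m a & forall h, lincomb e h -> proj m a h = h].
Proof.
suff [m [a [mk oa ea]]] : exists m a,
    [/\ (m <= k)%N, orthonormal_upto m a & forall i, proj m a (e i) = e i].
  exists m, a; split => // _ [c _ <-]; have [p pE] := linear_pack (@projP m a).
  rewrite pE linear_sum; apply: eq_bigr => i _.
  by rewrite linearZ/= -pE ea.
elim: k e => [e|k IH e].
  by exists 0%N, (fun=> 0); split => //; case.
have [m [a [mk oa ea]]] := IH (fun i => e (widen_ord (leqnSn k) i)).
(* [d] is the component of the last vector orthogonal to the previous ones. *)
pose d := e ord_max - proj m a (e ord_max).
have [d0|d0] := eqVneq d 0.
  exists m, a; split => //; first exact: leqW.
  move=> i; case: (unliftP ord_max i) => [j ->|->].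
    have -> : lift ord_max j = widen_ord (leqnSn k) j.
      by apply: val_inj; rewrite /= /bump leqNgt ltn_ord.
    exact: ea.
  by apply/esym/subr0_eq.
have nd0 : `|d| != 0 by rewrite normr_eq0.
have dda : dot d d = `|d| ^+ 2 by rewrite dot_norm.
set b := `|d|^-1 *: d.
have nc : Num.conj (`|d|^-1) = `|d|^-1 by rewrite geC0_conj// invr_ge0.
have db c : dot d (\sum_(j < m) c j *: a j) = 0 by exact: dot_sub_projr.
have bproj h : dot b (proj m a h) = 0.
  by rewrite /b linearZl_LR/= (db (fun i => dot h (a i))) mulr0.
have projb h : dot (proj m a h) b = 0 by rewrite hermC/= expr0 mul1r bproj rmorph0.
have bb : dot b b = 1.
  by rewrite /b linearZl_LR linearZr_LR/= dda nc expr2 mulKf// mulVf.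
have ba i : (i < m)%N -> dot b (a i) = 0.
  move=> im; rewrite /b linearZl_LR/=.
  by rewrite (@dot_sub_proj m a _ (Ordinal im))// mulr0.
pose a' n := if n == m then b else a n.
have a'lt i : (i < m)%N -> a' i = a i by move=> im; rewrite /a' ltn_eqF.
have a'm : a' m = b by rewrite /a' eqxx.
have pE h : proj m.+1 a' h = proj m a h + dot h b *: b.
  rewrite /proj big_ord_recr/= a'm; congr (_ + _).
  by apply: eq_bigr => i _; rewrite a'lt.
exists m.+1, a'; split => //.
  move=> i j; rewrite !ltnS leq_eqVlt => /predU1P[->|im]; last first.
    rewrite leq_eqVlt => /predU1P[->|jm]; last by rewrite !a'lt// oa.
    by rewrite a'm a'lt// hermC/= expr0 mul1r ba// rmorph0 ltn_eqF.
  rewrite leq_eqVlt => /predU1P[->|jm]; first by rewrite a'm bb eqxx.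
  by rewrite a'm a'lt// ba// gtn_eqF.
move=> i; rewrite pE; case: (unliftP ord_max i) => [j ->|->].
  have -> : lift ord_max j = widen_ord (leqnSn k) j.
    by apply: val_inj; rewrite /= /bump leqNgt ltn_ord.
  by rewrite -[in X in dot X b]ea projb scale0r addr0 ea.
have -> : e ord_max = d + proj m a (e ord_max) by rewrite subrK.
rewrite linearDl/= projb addr0 -/d; have [p pr] := linear_pack (@projP m a).
rewrite pr linearD/= -!pr addrAC.
have -> : proj m a d = 0.
  by rewrite /proj big1// => l _; rewrite dot_sub_proj// scale0r.
rewrite add0r; congr (_ + _); last exact: (proj_lincomb (fun i => dot _ (a i))).
rewrite /b linearZr_LR/= nc dda scalerA.
by rewrite mulrAC -expr2 -exprMn mulVf// expr1n scale1r.
Qed.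

(** The coefficients of the [e j] with respect to the [u l] form a [k * m] matrix;
    linear independence says that its left kernel is trivial, i.e. that its rank
    is [k]. *)
Lemma lin_indep_card k m (e : 'I_k -> H) (u : 'I_m -> H) :
  lin_indep e -> (forall j, lincomb u (e j)) -> (k <= m)%N.
Proof.
move=> le eu.
have /choice[A AE] j : exists b, \sum_(i < m) b i *: u i = e j.
  by have [b _ <-] := eu j; exists b.
pose M : 'M[R[i]]_(k, m) := \matrix_(j, l) A j l.
have: row_free M.
  rewrite -kermx_eq0; apply/negP => /negP/rowV0Pn[v /sub_kermxP vM /negP]; apply.
  apply/eqP/rowP => j; rewrite mxE; apply: (le (fun j => v ord0 j)).
  under eq_bigr do rewrite -AE scaler_sumr.
  rewrite exchange_big/= big1// => l _.
  under eq_bigr do rewrite scalerA.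
  rewrite -scaler_suml; have := congr1 (fun N : 'rV_m => N ord0 l) vM.
  by rewrite !mxE; under eq_bigr do rewrite mxE; move=> ->; rewrite scale0r.
by rewrite /row_free => /eqP <-; exact: rank_leq_col.
Qed.

Lemma gt0_complex (e : R[i]) : 0 < e -> exists2 d : R, 0 < d & e = d%:C.
Proof. by case: e => x y; rewrite ltcE/= => /andP[/eqP-> x0]; exists x. Qed.

Lemma normcR (a : R) : `|a%:C : R[i]| = `|a|%:C.
Proof. by rewrite normc_def/= expr0n/= addr0 sqrtr_sqr. Qed.

Lemma continuous_scaleRl (z : H) : continuous (fun a : R => a%:C *: z).
Proof.
move=> a; apply/cvgrPdist_lt => _ /gt0_complex[e e0 ->].
have d0 : 0 < hnorm z + 1 by rewrite ltr_wpDl// hnorm_ge0.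
near=> t.
rewrite -scalerBl -rmorphB/= normrZ normcR -hnormE -rmorphM/= ltcR.
have : `|a - t| < e / (hnorm z + 1).
  by near: t; apply: cvgr_dist_lt; rewrite ?divr_gt0.
rewrite ltr_pdivlMr//; apply: le_lt_trans.
by rewrite ler_wpM2l// lerDl.
Unshelve. all: by end_near. Qed.

(** A complex disc lies in the sum of a real and of an imaginary segment, which
    are compact as continuous images of real segments. *)
Lemma compact_disc (w : H) (M : R) :
  exists2 K : set H, compact K & forall c : R[i], `|c| <= M%:C -> K (c *: w).
Proof.
pose seg (z : H) : set H := (fun a : R => a%:C *: z) @` `[- M, M]%classic.
have cseg z : compact (seg z).
  apply: continuous_compact (@segment_compact _ _ _).
  exact/continuous_subspaceT/continuous_scaleRl.
exists ((fun p : H * H => p.1 + p.2) @` (seg w `*` seg ('i *: w))).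
  apply: continuous_compact (compact_setX (cseg _) (cseg _)).
  by apply/continuous_subspaceT => p; exact: add_continuous.
move=> c cM; exists ((complex.Re c)%:C *: w, (complex.Im c)%:C *: ('i *: w)) => /=.
  split; [exists (complex.Re c)|exists (complex.Im c)] => //=.
    rewrite in_itv/= -ler_norml -lecR; apply: le_trans cM.
    exact: normc_ge_Re.
  rewrite in_itv/= -ler_norml -lecR; apply: le_trans cM.
  by rewrite normc_def lecR -sqrtr_sqr ler_wsqrtr// lerDr sqr_ge0.
rewrite scalerA -scalerDl; congr (_ *: _).
by rewrite mulrC [RHS]complexE.
Qed.

(** The image of the unit ball lies in a finite sum of compact discs. *)
Lemma compact_finrank m w (phi : nat -> H -> R[i]) (M : R) S : linear S ->
  (forall h, S h = \sum_(i < m) phi i h *: w i) ->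
  (forall i h, (i < m)%N -> `|h| <= 1 -> `|phi i h| <= M%:C) -> compact_op S.
Proof.
move=> lS SE phiM; split => //.
suff [K cK KP] : exists2 K : set H, compact K &
    forall c, (forall i, (i < m)%N -> `|c i| <= M%:C) ->
      K (\sum_(i < m) c i *: w i).
  apply: (@precompact_subset _ _ K); last first.
    by rewrite precompact_closed//; apply: compact_closed cK; exact: norm_hausdorff.
  move=> _ [h h1 <-]; rewrite SE; apply: (KP (phi^~ h)) => i im.
  exact: phiM.
elim: m {SE phiM} => [|m [K cK KP]].
  exists [set 0]; first exact: compact_set1.
  by move=> c _; rewrite big_ord0.
have [D cD DP] := compact_disc (w m) M.
exists ((fun p : H * H => p.1 + p.2) @` (K `*` D)).
  apply: continuous_compact (compact_setX cK cD).
  by apply/continuous_subspaceT => p; exact: add_continuous.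
move=> c cM; exists (\sum_(i < m) c i *: w i, c m *: w m).
  by split => /=; [apply: KP => i im; apply: cM; exact: leqW|exact/DP/cM].
by rewrite big_ord_recr.
Qed.

Lemma compact_op0 : compact_op (0 : H -> H).
Proof.
apply: (@compact_finrank 0 (fun=> 0) (fun _ _ => 0) 0) => //.
  by move=> c h h'; rewrite /= addr0 scaler0.
by move=> h; rewrite big_ord0.
Qed.

(** The partial sums of the decomposition at [v j] are constant beyond the index [j]. *)
Lemma svd_vect S lam u v j : is_svd dot S lam u v -> S (v j) = (lam j)%:C *: u j.
Proof.
move=> [_ ov _ _ _ /(_ (v j)) cS].
apply: cvg_unique cS _; first exact: norm_hausdorff.
apply: cvg_near_cst; near=> n.
have jn : (j < n)%N by near: n; exact: nbhs_infty_gt.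
rewrite (bigD1 (Ordinal jn))//= ov eqxx scale1r big1 ?addr0// => i /negbTE ij.
rewrite ov eq_sym; move: ij; rewrite -val_eqE/= => ->.
by rewrite scale0r scaler0.
Unshelve. all: by end_near. Qed.

Lemma lincomb_mem n (e : 'I_n -> H) i : lincomb e (e i).
Proof.
exists (fun j => (j == i)%:R) => //; rewrite (bigD1 i)//= eqxx scale1r.
by rewrite big1 ?addr0// => j /negbTE ->; rewrite scale0r.
Qed.

(** The existence of a singular value decomposition is a conclusion: without one
    the truncation is 0, whose rank is not positive. As [lam] is non-increasing,
    [{i | eps <= lam i}] is an initial segment of [nat], and it is at least as long
    as the rank of the truncation, which is a sum over it. *)
Lemma op_rank_truncP eps S k : 0 < eps -> (0 < k)%N ->
  op_rank (eps_trunc dot eps S) = k ->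
  exists lam u v, is_svd dot S lam u v /\ forall i, (i < k)%N -> eps <= lam i.
Proof.
move=> e0 k0 rk.
have [b [lb rb]] : has_rank (eps_trunc dot eps S) k.
  rewrite -rk /op_rank; case: xgetP => [n _ //|none].
  by move: rk k0; rewrite /op_rank xgetPN// => <-.
have bran j : range (eps_trunc dot eps S) (b j) by rewrite rb; exact: lincomb_mem.
move: bran; rewrite /eps_trunc.
case: xgetP => [_ -> [lam [u [v [sv TE]]]] bran|_ bran]; last first.
  have : (k <= 0)%N; last by rewrite leqNgt k0.
  apply: (@lin_indep_card _ _ b (fun=> 0)) lb _ => j.
  by have [h _ <-] := bran j; exists (fun=> 0) => //; rewrite big_ord0.
exists lam, u, v; split => // i ik; rewrite leNgt; apply/negP => lami.
have : (k <= i)%N; last by rewrite leqNgt ik.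
apply: (@lin_indep_card _ _ b (fun l : 'I_i => u l)) lb _ => j.
have [h _ <-] := bran j; rewrite TE.
(* If [lam i < eps] with [i < k], the truncation maps into the span of
   [u 0, ..., u i.-1], which is too small for [k] independent vectors. *)
have sub : [set l | eps <= lam l] `<=` `I_i.
  move=> l /= le; rewrite ltnNge; apply/negP => il.
  by move: lami; rewrite ltNge (le_trans le)// (svd_noninc sv).
exists (fun l : 'I_i => if eps <= lam l then (lam l)%:C * dot h (v l) else 0) => //.
rewrite -(setIidr sub) fsbig_mkcondr -fsbig_ord; apply: eq_bigr => l _.
have -> : (nat_of_ord l \in [set l | eps <= lam l]) = (eps <= lam l).
  by apply/idP/idP; rewrite inE.
by case: ifP => _; rewrite ?scale0r ?scalerA.
Qed.

Lemma ler_hnorm (h k : H) (c : R) :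
  (`|h| <= c%:C * `|k|) = (hnorm h <= c * hnorm k).
Proof. by rewrite -!hnormE -rmorphM/= lecR. Qed.

(** Let [a] be an orthonormal basis of the range of [T], of size [m <= rank T].
    Then [B = sum_(i < m) <T _, a_i> v_i] carries the range of [T] isometrically to
    right singular vectors of [S], on which [S v_i = lam_i u_i], and
    [A = sum_(i < m) lam_i^-1 <_, u_i> a_i] carries the result back. The norm of [A]
    is at most [1/eps] because [lam_i >= eps] for all [i < m]. *)
Lemma rank_factor S T eps (M : R) : 0 < eps -> linear S -> linear T ->
  (forall h, hnorm (T h) <= M * hnorm h) -> finite_rank T ->
  op_rank T = op_rank (eps_trunc dot eps S) ->
  exists A B : H -> H,
    [/\ compact_op A, compact_op B,
        forall h, hnorm (A h) <= eps^-1 * hnorm h,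
        forall h, hnorm (B h) <= hnorm (T h) &
        forall h, T h = A (S (B h))].
Proof.
move=> e0 lS lT TM [n rn]; set k := op_rank T => rk.
have {n rn} [e [le re]] : has_rank T k by apply: xgetPex; exists n.
have Tlc h : lincomb e (T h) by rewrite -re; exists h.
have [k0|k0] := posnP k.
  have T0 h : T h = 0.
    by move: e re Tlc {le}; rewrite k0 => e _ Tlc; have [c _ <-] := Tlc h; rewrite big_ord0.
  exists 0, 0; split; rewrite //; try exact: compact_op0.
  - by move=> h; rewrite hnorm0 mulr_ge0 ?hnorm_ge0// invr_ge0 ltW.
  - by move=> h; rewrite hnorm0 hnorm_ge0.
have [lam [u [v [sv lame]]]] := op_rank_truncP e0 k0 (esym rk).
have [m [a [mk oa ea]]] := gram_schmidt e.
have {}lame i : (i < m)%N -> eps <= lam i by move=> im; apply/lame/(leq_trans im).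
have ou : orthonormal_upto m u by move=> i j _ _; exact: svd_orthol sv _ _.
have ov : orthonormal_upto m v by move=> i j _ _; exact: svd_orthor sv _ _.
pose al i h := (lam i)^-1%:C * dot h (u i).
pose A h := \sum_(i < m) al i h *: a i.
pose B h := \sum_(i < m) dot (T h) (a i) *: v i.
have lA : linear A.
  move=> c h h'; rewrite /A scaler_sumr -big_split/=; apply: eq_bigr => i _.
  rewrite /al linearDl/= linearZl_LR/= mulrDr scalerDl scalerA; congr (_ *: _ + _).
  by rewrite mulrCA.
have lB : linear B.
  move=> c h h'; rewrite /B scaler_sumr -big_split/=; apply: eq_bigr => i _.
  by rewrite lT linearDl/= linearZl_LR/= scalerDl scalerA.
have Bn h : hnorm (B h) <= hnorm (T h).
  rewrite -[leRHS]mul1r -ler_hnorm mul1r -(@ler_pXn2r _ 2) ?nnegrE//.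
  by rewrite (@norm_lincomb m v (fun i => dot (T h) (a i)))//; exact: bessel.
have coef_le b c (i : 'I_m) : orthonormal_upto m b ->
    `|c i| <= `|\sum_(j < m) c j *: b j|.
  move=> ob; rewrite -(@ler_pXn2r _ 2) ?nnegrE// norm_lincomb//.
  by rewrite (bigD1 i)//= lerDl sumr_ge0// => j _; rewrite exprn_ge0.
have An h : hnorm (A h) <= eps^-1 * hnorm h.
  rewrite -ler_hnorm -(@ler_pXn2r _ 2) ?nnegrE// ?mulr_ge0//; last first.
    by rewrite lecR invr_ge0 ltW.
  rewrite (@norm_lincomb m a (fun i => al i h))// exprMn.
  apply: (le_trans _ (ler_wpM2l _ (bessel h ou))); last first.
    by rewrite exprn_ge0// lecR invr_ge0 ltW.
  rewrite mulr_sumr; apply: ler_sum => i _; rewrite /al normrM exprMn.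
  have lami : eps <= lam i by exact: lame.
  rewrite normcR ler_wpM2r ?exprn_ge0// ler_pXn2r ?nnegrE ?lecR ?invr_ge0 ?(ltW e0)//.
  rewrite ger0_norm ?invr_ge0 ?(le_trans (ltW e0))//.
  by rewrite lef_pV2// posrE ?(lt_le_trans e0).
have h1 (h : H) : `|h| <= 1 -> hnorm h <= 1 by rewrite -lecR hnormE.
exists A, B; split => //.
- apply: (@compact_finrank m a al eps^-1) => // i h im hle.
  apply: (le_trans (coef_le a (al^~ h) (Ordinal im) oa)).
  rewrite -/(A h) -hnormE lecR (le_trans (An h))// ler_piMr ?h1//.
  by rewrite invr_ge0 ltW.
- apply: (@compact_finrank m v (fun i h => dot (T h) (a i)) `|M|) => // i h im hle.
  apply: (le_trans (coef_le v (fun i => dot (T h) (a i)) (Ordinal im) ov)).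
  rewrite -/(B h) -hnormE lecR (le_trans (Bn h))// (le_trans (TM h))//.
  apply: (le_trans (ler_wpM2r (hnorm_ge0 h) (ler_norm M))).
  by rewrite ler_piMr ?h1.
move=> h; rewrite -[LHS]ea// /proj.
have [s sE] := linear_pack lS; have [A' AE] := linear_pack lA.
rewrite /B sE linear_sum AE linear_sum; apply: eq_bigr => i _.
rewrite !linearZ/= -sE (svd_vect _ sv) linearZ/= -AE; congr (_ *: _).
have lami : (lam i)%:C != 0 :> R[i].
  by rewrite eq_complex/= eqxx andbT gt_eqF// (lt_le_trans e0)// lame.
rewrite /A scaler_sumr (bigD1 i)//= /al (svd_orthol sv) eqxx mulr1 scalerA.
rewrite -rmorphM/= mulfV; last by rewrite gt_eqF// (lt_le_trans e0)// lame.
rewrite scale1r big1 ?addr0// => j /negbTE ji.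
by rewrite (svd_orthol sv) eq_sym; move: ji; rewrite -val_eqE/= => ->; rewrite mulr0 scale0r scaler0.
Qed.
End Hilbert.

(** * Operators on square-summable families *)

Lemma esumZ_le (R : realType) (T : choiceType) (A : set T) (c : R) (a : T -> \bar R) :
  0 <= c -> (forall x, 0 <= a x)%E ->
  (\esum_(x in A) (c%:E * a x) <= c%:E * \esum_(x in A) a x)%E.
Proof.
move=> c0 a0; apply: ge_ereal_sup => _ [F [finF FA] <-].
rewrite -ge0_mule_fsumr//; apply: lee_wpmul2l; first by rewrite lee_fin.
by apply: ereal_sup_ubound; exists F.
Qed.

(** The Cauchy-Schwarz inequality against the constant family 1. *)
Lemma sqr_sum_le (R : realFieldType) (I : Type) (s : seq I) (a : I -> R) :
  (\sum_(i <- s) a i) ^+ 2 <= (size s)%:R * \sum_(i <- s) a i ^+ 2.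
Proof.
elim: s => [|x s IH]; first by rewrite !big_nil expr0n mul0r.
rewrite !big_cons /=; move: IH.
set S := \sum_(i <- s) a i; set Q := \sum_(i <- s) a i ^+ 2 => IH.
have Q0 : 0 <= Q by apply: sumr_ge0 => i _; exact: sqr_ge0.
have [s0|s0] := posnP (size s).
  have -> : S = 0 by rewrite /S (size0nil s0) big_nil.
  by rewrite s0 addr0 mul1r lerDl.
have n0 : 0 < (size s)%:R :> R by rewrite ltr0n.
(* The induction step amounts to [2 a_x S <= n a_x^2 + Q], which follows
   from [(n a_x - S)^2 >= 0] and [S^2 <= n Q] after multiplication by [n]. *)
have : 0 <= (size s)%:R * ((size s)%:R * a x ^+ 2 + Q - 2 * a x * S).
  have -> : (size s)%:R * ((size s)%:R * a x ^+ 2 + Q - 2 * a x * S) =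
      ((size s)%:R * a x - S) ^+ 2 + ((size s)%:R * Q - S ^+ 2) by ring.
  by rewrite addr_ge0 ?sqr_ge0 ?subr_ge0.
rewrite pmulr_rge0// -natr1; nra.
Qed.

Section L2.
Context {R : realType} {X : choiceType} {H : completeNormedModType R[i]}.
Implicit Types (f g : l2 X H) (T S Z : l2 X H -> l2 X H) (a : X -> H -> H).

Lemma sqsum_ge0 (f : X -> H) : (0 <= sqsum f)%E.
Proof. by apply: esum_ge0 => x _; rewrite lee_fin sqr_ge0. Qed.

Lemma sqsum_lty f : (sqsum f < +oo)%E.
Proof. by case: f => f /= /asboolP. Qed.

Lemma sqsumE f : sqsum f = (l2norm f ^+ 2)%:E.
Proof.
rewrite /l2norm sqr_sqrtr ?fine_ge0 ?sqsum_ge0// fineK//.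
by rewrite ge0_fin_numE ?sqsum_ge0 ?sqsum_lty.
Qed.

Lemma sqsum_dom (c : R) (f g : X -> H) : 0 <= c ->
  (forall x, hnorm (g x) <= c * hnorm (f x)) ->
  (sqsum g <= (c ^+ 2)%:E * sqsum f)%E.
Proof.
move=> c0 gf; apply: (le_trans _ (esumZ_le _ _ _)); rewrite ?sqr_ge0//; last first.
  by move=> x; rewrite lee_fin sqr_ge0.
apply: le_esum => x _; rewrite -EFinM lee_fin -exprMn.
by rewrite lerXn2r ?nnegrE ?mulr_ge0 ?hnorm_ge0.
Qed.

Lemma hnorm_le_sqsum (f : X -> H) x : ((hnorm (f x) ^+ 2)%:E <= sqsum f)%E.
Proof.
apply: esum_ge; exists [set x]; first by split => //; exact: finite_set1.
by rewrite fsbig_set1.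
Qed.

Lemma sqsum_delta y h : sqsum (l2delta y h : l2 X H) = (hnorm h ^+ 2)%:E.
Proof.
rewrite /sqsum (esumID [set y]); last by move=> x _; rewrite lee_fin sqr_ge0.
rewrite setTI esum_set1 ?lee_fin ?sqr_ge0//= /delta_fun eqxx esum1 ?adde0//.
by move=> x [_ /= /eqP /negbTE ->]; rewrite hnorm0 expr0n.
Qed.

(** A crude form of the triangle inequality, sufficient for estimates up to a
    constant. *)
Lemma sqsumD (f g : X -> H) :
  (sqsum (f + g)%R <= 2%:E * sqsum f + 2%:E * sqsum g)%E.
Proof.
have n0 (h : X -> H) x : (0 <= (hnorm (h x) ^+ 2)%:E)%E by rewrite lee_fin sqr_ge0.
apply: (@le_trans _ _ (\esum_(x in setT) (2%:E * (hnorm (f x) ^+ 2)%:E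
                          + 2%:E * (hnorm (g x) ^+ 2)%:E))%E).
  apply: le_esum => x _; rewrite -!EFinM -EFinD lee_fin.
  set p := hnorm (f x); set q := hnorm (g x).
  have pq : hnorm ((f + g) x) ^+ 2 <= (p + q) ^+ 2.
    rewrite lerXn2r ?nnegrE ?addr_ge0 ?hnorm_ge0//.
    exact: Defs.hnormD (f x) (g x).
  by have := sqr_ge0 (p - q); nra.
rewrite esumD; try by move=> x _; rewrite mule_ge0// lee_fin.
by apply: leeD; apply: esumZ_le.
Qed.

Lemma l2norm_ge0 f : 0 <= l2norm f.
Proof. exact: sqrtr_ge0. Qed.

Lemma l2valD f g x : (f + g) x = f x + g x. Proof. by []. Qed.
Lemma l2valB f g x : (f - g) x = f x - g x. Proof. by []. Qed.
Lemma l2valZ (c : R[i]) f x : (c *: f) x = c *: f x. Proof. by []. Qed.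
Lemma l2val_sum (I : Type) (s : seq I) (P : pred I) (F : I -> l2 X H) x :
  (\sum_(i <- s | P i) F i) x = \sum_(i <- s | P i) F i x.
Proof. by elim/big_ind2 : _ => // u v u' v' <- <-. Qed.

Lemma l2eqP f g : (forall x, f x = g x) -> f = g.
Proof. by move=> fg; apply/val_inj/funext. Qed.

(** [C] bounds the square of the operator norm: squared norms are sums over [X],
    hence can be estimated coordinatewise. *)
Definition opbound (C : R) T := forall f, (sqsum (T f) <= C%:E * sqsum f)%E.

Lemma bounded_op_opbound T : bounded_op T -> exists2 C, 0 <= C & opbound C T.
Proof.
move=> [_ [M TM]]; exists (M ^+ 2); first exact: sqr_ge0.
move=> f; rewrite !sqsumE -EFinM lee_fin -exprMn.
rewrite lerXn2r ?nnegrE ?l2norm_ge0// (le_trans _ (TM f)) ?l2norm_ge0//.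
Qed.

Lemma opbound_l2norm C T f : 0 <= C -> opbound C T ->
  l2norm (T f) <= Num.sqrt C * l2norm f.
Proof.
move=> C0 /(_ f); rewrite !sqsumE -EFinM lee_fin => Tf.
rewrite -(@ler_pXn2r _ 2) ?nnegrE ?mulr_ge0 ?l2norm_ge0 ?sqrtr_ge0//.
by rewrite exprMn (sqr_sqrtr C0).
Qed.

Lemma opbound_bounded_op C T : linear T -> 0 <= C -> opbound C T -> bounded_op T.
Proof.
by move=> lT C0 CT; split => //; exists (Num.sqrt C) => f; exact: opbound_l2norm.
Qed.

Lemma l2norm0 : l2norm (0 : l2 X H) = 0.
Proof.
rewrite /l2norm /sqsum esum1 ?sqrtr0// => x _.
by rewrite [X in hnorm X](_ : _ = 0)// hnorm0 expr0n.
Qed.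

Lemma opnorm_le C T : 0 <= C -> opbound C T -> opnorm T <= Num.sqrt C.
Proof.
move=> C0 CT; apply: ge_sup; first by exists (l2norm (T 0)), 0 => //=; rewrite l2norm0.
move=> _ [f /= f1 <-]; apply: (le_trans (opbound_l2norm f C0 CT)).
by rewrite ler_piMr ?sqrtr_ge0.
Qed.

Lemma hnormZR (c : R) (h : H) : hnorm (c%:C *: h) = `|c| * hnorm h.
Proof. by rewrite hnormZ normc_def/= expr0n/= addr0 sqrtr_sqr. Qed.

Lemma l2normZ_le (c : R) f : 0 <= c -> l2norm (c%:C *: f) <= c * l2norm f.
Proof.
move=> c0; rewrite -(@ler_pXn2r _ 2) ?nnegrE ?mulr_ge0 ?l2norm_ge0//.
rewrite exprMn -lee_fin [leRHS]EFinM -!sqsumE; apply: sqsum_dom => // x.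
by rewrite l2valZ hnormZR ger0_norm.
Qed.

(** Scale a nonzero vector to the unit ball. If [f] has norm 0 then so has [T f],
    because [T] is bounded. *)
Lemma opbound_opnorm d T : bounded_op T -> opnorm T < d -> opbound (d ^+ 2) T.
Proof.
move=> bT Td; have [C C0 CT] := bounded_op_opbound bT.
have [T' TE] := linear_pack bT.1.
have d0 : 0 < d.
  apply: le_lt_trans Td; apply: (le_trans (l2norm_ge0 (T 0))).
  apply: ub_le_sup; last by exists 0 => //=; rewrite l2norm0.
  exists (Num.sqrt C) => _ [f /= f1 <-]; apply: (le_trans (opbound_l2norm f C0 CT)).
  by rewrite ler_piMr ?sqrtr_ge0.
move=> f; have [f0|f0] := eqVneq (l2norm f) 0.
  by apply: (le_trans (CT f)); rewrite (sqsumE f) f0 expr0n/= !mule0.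
have n0 : 0 < l2norm f by rewrite lt_def f0 l2norm_ge0.
rewrite !sqsumE -EFinM lee_fin -exprMn.
rewrite ler_pXn2r ?nnegrE ?mulr_ge0 ?l2norm_ge0 ?(ltW d0)//.
set g := ((l2norm f)^-1)%:C *: f.
have fE : f = (l2norm f)%:C *: g.
  by rewrite scalerA -rmorphM/= mulfV// scale1r.
have g1 : l2norm g <= 1.
  by apply: (le_trans (l2normZ_le _ _)); rewrite ?mulVf// invr_ge0 ltW.
have Tg : l2norm (T g) <= d.
  apply: le_trans (ltW Td); apply: ub_le_sup; last by exists g.
  exists (Num.sqrt C) => _ [k /= f1 <-]; apply: (le_trans (opbound_l2norm k C0 CT)).
  by rewrite ler_piMr ?sqrtr_ge0.
rewrite [in T f]fE TE linearZ/= -TE (le_trans (l2normZ_le _ _)) ?l2norm_ge0//.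
by rewrite mulrC ler_wpM2r ?l2norm_ge0.
Qed.

Lemma opboundD C D S T : opbound C S -> opbound D T ->
  opbound (2 * C + 2 * D) (S + T).
Proof.
move=> CS DT f; apply: (le_trans (sqsumD (S f) (T f))).
move: (CS f) (DT f); rewrite !sqsumE -!EFinM -EFinD !lee_fin; nra.
Qed.

Lemma opboundN C T : opbound C T -> opbound C (- T).
Proof.
move=> CT f; rewrite (_ : sqsum _ = sqsum (T f))//.
apply: eq_esum => x _; congr (_ ^+ 2)%:E.
by rewrite (_ : (- T) f x = - (T f x))// /hnorm normrN.
Qed.

Lemma bounded_opB S T : bounded_op S -> bounded_op T -> bounded_op (S - T).
Proof.
move=> bS bT; have [C C0 CS] := bounded_op_opbound bS; have [D D0 DT] := bounded_op_opbound bT.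
apply: (@opbound_bounded_op (2 * C + 2 * D)).
- move=> c f g; have [S' SE] := linear_pack bS.1; have [T' TE] := linear_pack bT.1.
  have ST h : (S - T) h = S h - T h by [].
  by rewrite !ST SE TE (linearP S') (linearP T') scalerBr opprD addrACA.
- by rewrite addr_ge0 ?mulr_ge0.
exact: opboundD CS (opboundN DT).
Qed.

Definition block_bound (C : R) a :=
  (forall x, linear (a x)) /\ (forall x h, hnorm (a x h) <= C * hnorm h).

(** The block-diagonal operator with blocks [a x]. The default value of [insubd]
    is never reached when the blocks are uniformly bounded, see [diagE]. *)
Definition diag a f : l2 X H := insubd (0 : l2 X H) (fun x => a x (f x)).

Lemma diagE C a f x : 0 <= C -> block_bound C a -> diag a f x = a x (f x).
Proof.
move=> C0 [_ aC]; rewrite /diag val_insubd ifT//; apply/asboolP.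
apply: (le_lt_trans (sqsum_dom C0 (fun x => aC x (f x)))).
by rewrite lte_mul_pinfty ?lee_fin ?sqr_ge0 ?sqsum_lty.
Qed.

Lemma diag_opbound C a : 0 <= C -> block_bound C a -> opbound (C ^+ 2) (diag a).
Proof.
move=> C0 aC f; apply: sqsum_dom => // x; rewrite (diagE _ _ C0 aC).
by have [_ ] := aC; apply.
Qed.

Lemma diag_linear C a : 0 <= C -> block_bound C a -> linear (diag a).
Proof.
move=> C0 aC c f g; apply: l2eqP => x.
by rewrite !(l2valD, l2valZ) !(diagE _ _ C0 aC) !(l2valD, l2valZ) aC.1.
Qed.

Lemma diag_bounded C a : 0 <= C -> block_bound C a -> bounded_op (diag a).
Proof.
move=> C0 aC; apply: opbound_bounded_op (diag_opbound C0 aC); rewrite ?sqr_ge0//.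
exact: diag_linear C0 aC.
Qed.

Lemma diag_delta C a y h : 0 <= C -> block_bound C a ->
  diag a (l2delta y h) = l2delta y (a y h).
Proof.
move=> C0 aC; apply: l2eqP => x; rewrite (diagE _ _ C0 aC)/= /delta_fun.
by case: eqP => [->//|_]; have [g ->] := linear_pack (aC.1 x); rewrite linear0.
Qed.

Lemma l2delta_linear y : linear (l2delta y : H -> l2 X H).
Proof.
move=> c h k; apply: l2eqP => x; rewrite !(l2valD, l2valZ)/= /delta_fun.
by case: eqP => // _; rewrite scaler0 addr0.
Qed.

Lemma entry_linear T x y : linear T -> linear (entry T x y).
Proof. by move=> lT c h k; rewrite /entry l2delta_linear lT. Qed.

Lemma entry_hnorm C T x y h : opbound C T -> hnorm (entry T x y h) ^+ 2 <= C * hnorm h ^+ 2.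
Proof.
move=> CT; rewrite -lee_fin [leRHS]EFinM -(sqsum_delta y h) /entry.
exact: le_trans (hnorm_le_sqsum (T (l2delta y h)) x) (CT (l2delta y h)).
Qed.

Definition l2tail (F : {fset X}) f : l2 X H :=
  f - \sum_(y <- F) l2delta y (f y).

(** By definition of [sqsum] as a supremum, some finite partial sum is [e]-close
    to it; [l2tail F f] is the restriction of [f] to the complement of [F]. *)
Lemma l2tail_small f (e : R) : 0 < e -> exists F0 : {fset X}, forall F : {fset X},
  (F0 `<=` F)%fset -> (sqsum (l2tail F f) <= e%:E)%E.
Proof.
move=> e0; have n0 x : (0 <= (hnorm (f x) ^+ 2)%:E)%E by rewrite lee_fin sqr_ge0.
have : (sqsum f - e%:E < sqsum f)%E.
  by rewrite sqsumE -EFinB lte_fin ltrBlDr ltrDl.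
move=> /ereal_sup_gt[_ [A [finA _] <-] lA].
exists (fset_set A) => F AF.
have FE x : l2tail F f x = if x \in F then 0 else f x.
  rewrite l2valB l2val_sum /=; case: ifPn => xF.
    rewrite (big_fsetD1 x)//= {1}/delta_fun eqxx big_seq big1 ?addr0 ?subrr//.
    move=> y; rewrite !inE => /andP[/eqP yx _].
    by rewrite /delta_fun; case: eqP => // xy; case: yx.
  rewrite big_seq big1 ?subr0// => y yF.
  by rewrite /delta_fun; case: eqP => // xy; rewrite xy yF in xF.
set t := (\esum_(x in ~` [set` F]) (hnorm (f x) ^+ 2)%:E)%E.
have fE : sqsum f = (\sum_(x \in [set` F]) (hnorm (f x) ^+ 2)%:E + t)%E.
  by rewrite /sqsum (esumID [set` F])// !setTI esum_fset.
have -> : sqsum (l2tail F f) = t.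
  rewrite /t esum_mkcond; apply: eq_esum => x _; rewrite FE.
  rewrite (_ : (x \in ~` [set` F]) = (x \notin F)); last first.
    by apply/idP/idP; rewrite inE => /negP.
  by case: ifP => //= _; rewrite hnorm0 expr0n.
have sA : (\sum_(x \in A) (hnorm (f x) ^+ 2)%:E <=
           \sum_(x \in [set` F]) (hnorm (f x) ^+ 2)%:E)%E.
  apply: lee_fsum_nneg_subset => //.
  by move=> x /set_mem Ax; apply/mem_set/(fsubsetP AF); rewrite in_fset_set//; exact/mem_set.
move: (lt_le_trans lA sA); have := sqsum_lty f; rewrite fE.
rewrite fsumEFin//.
have t0 : (0 <= t)%E by apply: esum_ge0 => x _; exact: n0.
move: t t0 {fE} => [t _ _| _|//]; last by rewrite addey.
by rewrite -EFinD lte_fin lee_fin => ?; lra.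
Qed.

(** A bounded operator is determined by its entries, by density of the finitely
    supported families: the tail of [f] contributes arbitrarily little to [T f x],
    and the truncation of [f] to any finite set that contains [B] contributes
    exactly the sum on the right. *)
Lemma finprop_eval T (B : {fset X}) x f : bounded_op T ->
  (forall y, y \notin B -> entry T x y = 0) ->
  T f x = \sum_(y <- B) entry T x y (f y).
Proof.
move=> bT TB; have [C C0 CT] := bounded_op_opbound bT; have [T' TE] := linear_pack bT.1.
apply/eqP; rewrite -subr_eq0; apply/eqP; set D := _ - _.
have DE F : (B `<=` F)%fset -> D = T (l2tail F f) x.
  move=> BF; rewrite /l2tail TE linearB linear_sum l2valB l2val_sum -TE.
  congr (_ - _); apply: big_fset_incl => // y _ yB.
  by rewrite -[LHS]/(entry T x y (f y)) TB.
have D0 (e : R) : 0 < e -> hnorm D ^+ 2 <= C * e.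
  move=> e0; have [F0 F0P] := l2tail_small f e0.
  rewrite (DE (F0 `|` B)%fset) ?fsubsetUr// -lee_fin.
  apply: (le_trans (hnorm_le_sqsum (T _) x)); apply: (le_trans (CT _)).
  by rewrite EFinM lee_wpmul2l ?lee_fin// F0P// fsubsetUl.
apply/eqP; rewrite -normr_eq0 -hnormE eq_complex/= eqxx andbT.
apply/negPn/negP => Dn; have {}Dn : 0 < hnorm D ^+ 2.
  by rewrite exprn_gt0// lt_def Dn hnorm_ge0.
have C1 : 0 < C + 1 by lra.
have := D0 (hnorm D ^+ 2 / (C + 1)) (divr_gt0 Dn C1).
rewrite mulrA ler_pdivlMr//; nra.
Qed.

(** By symmetry of [B], each [g y] is counted once for every [x] in [B y]. *)
Lemma esum_ball_exchange (B : X -> {fset X}) (g : X -> \bar R) (K : nat) :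
  (forall x, #|` B x| <= K)%N -> (forall x y, (y \in B x) = (x \in B y)) ->
  (forall x, 0 <= g x)%E ->
  (\esum_(x in [set: X]) \sum_(y <- B x) g y <= K%:R%:E * \esum_(x in [set: X]) g x)%E.
Proof.
move=> BK Bsym g0.
have sumE x : (\sum_(y <- B x) g y = \esum_(y in [set` B x]) g y)%E.
  by rewrite esum_fset// fsbig_finite//= set_fsetK.
under eq_esum do rewrite sumE.
rewrite esum_esum//.
set P := _ `*`` _.
have bijP : set_bij P P (fun k => (k.2, k.1)).
  split => [[x y]|[x y] [x' y'] _ _ [-> ->]//|[x y]] /=; rewrite /P /=.
    by move=> [_ yx]; split => //=; rewrite -Bsym.
  by move=> [_ /= yx]; exists (y, x) => //; split => //=; rewrite -Bsym.
rewrite (reindex_esum P P (fun k => (k.2, k.1)) _ bijP)/=.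
rewrite -(@esum_esum _ _ _ setT (fun x => [set` B x]) (fun x _ => g x))//; apply: (le_trans _ (esumZ_le _ _ _)) => //.
apply: le_esum => x _; rewrite esum_fset// fsbig_finite//= set_fsetK big_const_seq.
rewrite count_predT.
have -> n : iter n (adde (g x)) 0%E = (n%:R%:E * g x)%E.
  elim: n => [|n /= ->]; first by rewrite mul0e.
  by rewrite -natr1 EFinD ge0_muleDl ?lee_fin// mul1e addeC.
by rewrite lee_wpmul2r// lee_fin ler_nat.
Qed.

Lemma hnorm_sum (I : Type) (s : seq I) (F : I -> H) :
  hnorm (\sum_(i <- s) F i) <= \sum_(i <- s) hnorm (F i).
Proof.
elim/big_rec2 : _ => [|i x y _ xy]; first by rewrite hnorm0.
by rewrite (le_trans (Defs.hnormD _ _))// lerD2l.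
Qed.

Lemma hnorm_sum_sqr (I : Type) (s : seq I) (F : I -> H) (K : nat) :
  (size s <= K)%N ->
  hnorm (\sum_(i <- s) F i) ^+ 2 <= K%:R * \sum_(i <- s) hnorm (F i) ^+ 2.
Proof.
move=> sK; apply: (@le_trans _ _ ((\sum_(i <- s) hnorm (F i)) ^+ 2)).
  by rewrite lerXn2r ?nnegrE ?hnorm_sum ?hnorm_ge0// sumr_ge0// => i _; exact: hnorm_ge0.
apply: (le_trans (sqr_sum_le _ _)); rewrite ler_wpM2r ?ler_nat//.
by apply: sumr_ge0 => i _; exact: sqr_ge0.
Qed.

(** At each [x] the Cauchy-Schwarz inequality over the at most [K] points of [B x]
    costs one factor [K]; each [f y] is then used at most [K] times, which costs
    the second one. *)
Lemma schur_test (B : X -> {fset X}) (K : nat) (M : R) T : bounded_op T -> 0 <= M ->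
  (forall x, #|` B x| <= K)%N -> (forall x y, (y \in B x) = (x \in B y)) ->
  (forall x y, y \notin B x -> entry T x y = 0) ->
  (forall x y h, hnorm (entry T x y h) <= M * hnorm h) ->
  opbound ((K%:R * M) ^+ 2) T.
Proof.
move=> bT M0 BK Bsym TB TM f.
pose n (x : X) := ((hnorm (f x)) ^+ 2)%:E.
have n0 x : (0 <= n x)%E by rewrite lee_fin sqr_ge0.
have c0 : 0 <= K%:R * M ^+ 2 by rewrite mulr_ge0 ?sqr_ge0.
have s0 x : (0 <= \sum_(y <- B x) n y)%E by rewrite sume_ge0.
apply: (@le_trans _ _ (\esum_(x in setT) ((K%:R * M ^+ 2)%:E * \sum_(y <- B x) n y))%E).
  apply: le_esum => x _; rewrite (finprop_eval f bT (TB x)) sumEFin -EFinM lee_fin.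
  apply: (le_trans (hnorm_sum_sqr _ (BK x))).
  rewrite -mulrA ler_wpM2l// mulr_sumr ler_sum// => y _.
  by rewrite -exprMn lerXn2r ?nnegrE ?mulr_ge0 ?hnorm_ge0.
apply: (le_trans (esumZ_le _ _ _)) => //.
apply: (le_trans (lee_wpmul2l _ (esum_ball_exchange BK Bsym _))) => //.
by rewrite muleA -EFinM -mulrA (mulrC (M ^+ 2)) mulrA exprMn.
Qed.

(** The bound does not depend on the cardinal of [J]: at each point at most [K] of
    the blocks [a c x], and at most [K] of the blocks [b c x], are nonzero. *)
Lemma opbound_sum_diag (J : finType) (a b : J -> X -> H -> H) (D1 D2 : X -> {set J})
    (K : nat) (C1 C2 d : R) Z :
  0 <= C1 -> 0 <= C2 -> 0 <= d ->
  (forall x, #|D1 x| <= K)%N -> (forall x, #|D2 x| <= K)%N ->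
  (forall c x, c \notin D1 x -> a c x = 0) ->
  (forall c x, c \notin D2 x -> b c x = 0) ->
  (forall c, block_bound C1 (a c)) -> (forall c, block_bound C2 (b c)) ->
  opbound d Z ->
  opbound (K%:R * C1 ^+ 2 * (d * (K%:R * C2 ^+ 2)))
    (\sum_c (diag (a c) \o Z \o diag (b c))).
Proof.
move=> C10 C20 d0 D1K D2K aD bD aC bC Zd f.
have sq0 (h : H) : (0 <= (hnorm h ^+ 2)%:E)%E by rewrite lee_fin sqr_ge0.
pose g c := Z (diag (b c) f).
have K10 : 0 <= K%:R * C1 ^+ 2 by rewrite mulr_ge0 ?sqr_ge0.
have K20 : 0 <= K%:R * C2 ^+ 2 by rewrite mulr_ge0 ?sqr_ge0.
apply: (@le_trans _ _ ((K%:R * C1 ^+ 2)%:E * \sum_c sqsum (g c))%E).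
  rewrite -esum_sum//; apply: (le_trans _ (esumZ_le _ _ _)) => //; last first.
    by move=> x; exact: sume_ge0.
  apply: le_esum => x _; rewrite sumEFin -EFinM lee_fin.
  rewrite fct_sumE l2val_sum.
  rewrite (bigID (fun c => c \in D1 x))/= [X in _ + X]big1 ?addr0; last first.
    by move=> c cD; rewrite (diagE _ _ C10 (aC c)) aD.
  rewrite -big_enum/=; apply: (le_trans (hnorm_sum_sqr _ (_ : (_ <= K)%N))).
    by rewrite -cardE.
  rewrite -mulrA ler_wpM2l// big_enum/= mulr_sumr [leRHS](bigID (fun c => c \in D1 x))/=.
  rewrite (le_trans (_ : _ <= \sum_(i in D1 x) C1 ^+ 2 * hnorm (g i x) ^+ 2))//.
    apply: ler_sum => c _; rewrite -exprMn lerXn2r ?nnegrE ?mulr_ge0 ?hnorm_ge0//.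
    by rewrite (diagE _ _ C10 (aC c)); have [_] := aC c; apply.
  by rewrite lerDl sumr_ge0// => c _; rewrite mulr_ge0 ?sqr_ge0.
(* The three factors of the constant come from the [a c], from [Z] and from
   the [b c], in this order. *)
rewrite [in leRHS]EFinM -[leRHS]muleA lee_wpmul2l ?lee_fin//.
apply: (@le_trans _ _ (d%:E * \sum_c sqsum (diag (b c) f))%E).
  rewrite ge0_sume_distrr; last by move=> c _; exact: sqsum_ge0.
  by apply: lee_sum => c _; exact: Zd.
rewrite [in leRHS]EFinM -[leRHS]muleA lee_wpmul2l ?lee_fin//.
rewrite -esum_sum//; apply: (le_trans _ (esumZ_le _ _ _)) => //.
apply: le_esum => x _; rewrite sumEFin -EFinM lee_fin.
rewrite (bigID (fun c => c \in D2 x))/= [X in _ + X]big1 ?addr0; last first.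
  by move=> c cD; rewrite (diagE _ _ C20 (bC c)) bD// hnorm0 expr0n.
apply: (@le_trans _ _ (\sum_(c in D2 x) C2 ^+ 2 * hnorm (f x) ^+ 2)).
  apply: ler_sum => c _; rewrite -exprMn lerXn2r ?nnegrE ?mulr_ge0 ?hnorm_ge0//.
  by rewrite (diagE _ _ C20 (bC c)); have [_] := bC c; apply.
rewrite sumr_const -[leLHS]mulr_natl mulrA ler_wpM2r ?sqr_ge0//.
by rewrite ler_wpM2r ?sqr_ge0// ler_nat.
Qed.

End L2.

(** * Bounded geometry and rank distributions *)

Section Coarse.
Context {R : realType} {X : metricType R}.
Hypothesis bgX : bounded_geometry X.
Implicit Types (a b : X -> X -> nat) (RD : set (X -> X -> nat)) (r : R).

Definition cball (r : R) (x : X) : {fset X} := fset_set [set y | mdist x y <= r].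

Lemma finite_cball r x : finite_set [set y : X | mdist x y <= r].
Proof.
have r0 : 0 < `|r| + 1 by rewrite ltr_wpDl.
have [N NP] := bgX r0.
apply: (@sub_finite_set _ _ [set y | mdist x y <= `|r| + 1]).
  by move=> y /= /le_trans; apply; rewrite (le_trans (ler_norm r))// lerDl.
by apply/finite_set_leP; exists N.
Qed.

Lemma in_cball r x y : (y \in cball r x) = (mdist x y <= r).
Proof.
rewrite in_fset_set; last exact: finite_cball.
by apply/idP/idP; rewrite inE.
Qed.

Lemma cball_sym r x y : (y \in cball r x) = (x \in cball r y).
Proof. by rewrite !in_cball metric_sym. Qed.

Lemma card_cball r : exists K : nat, forall x, (#|` cball r x| <= K)%N.
Proof.
have r0 : 0 < `|r| + 1 by rewrite ltr_wpDl.
have [N NP] := bgX r0; exists N => x.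
apply: (@leq_trans #|` cball (`|r| + 1) x|); last exact: geq_card_fset_set.
apply/fsubset_leq_card/fsubsetP => y; rewrite !in_cball => /le_trans; apply.
by rewrite (le_trans (ler_norm r))// lerDl.
Qed.

(** [X] is the union of the finite balls of integer radius around a point. *)
Lemma countable_bounded_geometry : exists e : X -> nat, injective e.
Proof.
have [[x0]|X0] := pselect (exists x0 : X, True); last first.
  by exists (fun=> 0%N) => x; case: X0; exists x.
have /countable_injP[e eP] : countable [set: X].
  have -> : [set: X] = \bigcup_(n in [set: nat]) [set y | mdist x0 y <= n%:R].
    apply/seteqP; split => // y _; exists (Num.bound (mdist x0 y)) => //=.
    by rewrite ltW// archi_boundP// mdist_ge0.
  by apply: bigcup_countable => // n _; exact/finite_set_countable/finite_cball.
by exists e => x y; apply: eP; rewrite inE.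
Qed.

(** Greedy colouring: enumerate [X] and give each point one of [K + 1]
    colours not yet used among the at most [K] points of its ball. *)
Lemma coloring r : exists N (f : X -> 'I_N),
  forall x y, mdist x y <= r -> f x = f y -> x = y.
Proof.
have [K KP] := card_cball r; have [e e_inj] := countable_bounded_geometry.
have [fresh freshP] : exists fresh : (X -> 'I_K.+1) -> X -> 'I_K.+1,
    forall f x y, mdist x y <= r -> fresh f x != f y.
  pose used (f : X -> 'I_K.+1) x := [seq f y | y <- cball r x].
  exists (fun f x => odflt ord0 [pick c | c \notin used f x]) => f x y xy.
  case: pickP => [c cP|none] /=.
    by apply: contraNneq cP => ->; apply: map_f; rewrite in_cball.
  exfalso; have : (#|'I_K.+1| <= size (used f x))%N.
    apply: leq_trans (card_size _); apply/subset_leq_card/fintype.subsetP => c _.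
    by have /negbFE := none c.
  by rewrite card_ord size_map ltnNge KP.
have [F FE] : exists F : nat -> X -> 'I_K.+1,
    forall x n, (e x < n)%N -> F n x = fresh (F (e x)) x.
  (* [F n] is the partial colouring in which the points of index less than [n]
     have received their colours. *)
  pose step n g x := if e x == n then fresh g x else g x.
  exists (nat_rect (fun=> X -> 'I_K.+1) (fun=> ord0) step) => x.
  elim=> // n IH; rewrite ltnS leq_eqVlt /= {1}/step => /predU1P[<-|xn].
    by rewrite eqxx.
  by rewrite ltn_eqF// IH.
have [g gP] : exists g : X -> 'I_K.+1,
    forall x y, mdist x y <= r -> (e y < e x)%N -> g x != g y.
  exists (fun x => fresh (F (e x)) x) => x y xy yx.
  have := freshP (F (e x)) x y xy; rewrite (FE y (e x) yx); exact.
exists K.+1, g => x y xy gxy; case: (ltngtP (e x) (e y)) => [lt_e|lt_e|/e_inj//].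
  by have := gP y x; rewrite metric_sym gxy eqxx => /(_ xy lt_e).
by have := gP x y xy lt_e; rewrite gxy eqxx.
Qed.

Lemma closure_principal (T : Type) (A : set T) : closure (principal @` A) = bbase A.
Proof.
apply/seteqP; split=> [F|F FA V /nbhs_betaP[B FB BV]].
  have : principal @` A `<=` bbase A by move=> _ [x Ax <-]; exact/principal_filterP.
  by move=> /closureS /(_ F) h /h; rewrite -(closure_id _).1//; exact: closed_bbase.
have /filter_ex[x [Ax Bx]] : F (A `&` B) by exact: filterI.
by exists (principal x); split; [exists x|apply/BV/principal_filterP].
Qed.

Lemma range_closureE a : range_closure a = bbase (fst @` supp a).
Proof. exact: closure_principal. Qed.

(** If [A] is infinite, the complements in [A] of the finite sets generate a
    proper filter, and an ultrafilter that refines it is not principal. *)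
Lemma finite_bbase (T : Type) (A : set T) :
  bbase A `<=` range (@principal T) -> finite_set A.
Proof.
move=> AU; apply: contrapT => Ainf.
have FF : ProperFilter (filter_from [set B : set T | finite_set B] (fun B => A `\` B)).
  apply: filter_from_proper; first apply: filter_from_filter.
  - by exists set0; exact: finite_set0.
  - move=> B C /= fB fC; exists (B `|` C); first by rewrite /= finite_setU.
    by move=> x [Ax BC]; split; split => // ?; apply: BC; [left|right].
  move=> B /= fB; apply/set0P/eqP => AB0; apply: Ainf.
  by apply: sub_finite_set fB; rewrite -setD_eq0.
have [G [GU FG]] := ultraFilterLemma FF.
have GA : G A by apply: FG; exists set0 => //= x []; rewrite //; exact: finite_set0.
have [x _ xG] := AU (Beta GU) GA.
have : principal x (A `\ x).
  rewrite xG; apply: FG; exists [set x] => //=; exact: finite_set1.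
by move=> /principal_filterP [_] /=; apply.
Qed.

(** Compactness of [bbase A], with closure under sums to replace a finite
    subcover by a single rank function: if no [b] works, the sets
    [A \ fst(supp b)] form a filter base, and an ultrafilter that refines it
    belongs to [bbase A] but not to [open_of RD]. *)
Lemma rank_cover RD (A : set X) : rank_distribution RD -> bbase A `<=` open_of RD ->
  exists2 b, RD b & A `<=` fst @` supp b.
Proof.
move=> rd AU; apply: contrapT => none.
have R0 : RD (fun _ _ => 0%N).
  apply: (rd_fin rd); first by exists 0.
  by rewrite (_ : supp _ = set0)//; apply/seteqP; split.
have FF : ProperFilter (filter_from RD (fun b => A `\` fst @` supp b)).
  apply: filter_from_proper; first apply: filter_from_filter.
  - by exists (fun _ _ => 0%N).
  - move=> b c Rb Rc; exists (fun x y => b x y + c x y)%N; first exact: rd_add rd _ _ _ _.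
    move=> x [Ax nx]; split; split => // -[p /= pb px]; apply: nx; exists p => //;
      by rewrite /supp/= addn_eq0 negb_and pb ?orbT.
  move=> b Rb; apply/set0P/eqP => Ab0; apply: none; exists b => //.
  by rewrite -setD_eq0.
have [G [GU FG]] := ultraFilterLemma FF.
have GA : G A by apply: FG; exists (fun _ _ => 0%N) => // x [].
have [b Rb] := AU (Beta GU) GA; rewrite range_closureE => Gb.
have Gn : G (A `\` fst @` supp b) by apply: FG; exists b.
by have /filter_ex[x [? [_ ]]] : G (fst @` supp b `&` (A `\` fst @` supp b)) by exact: filterI.
Qed.

Lemma E_mulr_gt0 a E x y z : rank_function a -> a x z != 0%N -> E (z, y) ->
  (0 < E_mulr a E x y)%N.
Proof.
move=> [r ar] axz Ezy; rewrite /E_mulr.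
have fin : finite_set [set w | a x w != 0%N].
  by apply: sub_finite_set (finite_cball r x) => w; exact: ar.
rewrite -(@fsbig_widen _ _ _ _ [set w | a x w != 0%N])//; last first.
  by move=> w [_ /= /negP/negPn/eqP ->]; rewrite mul0n.
rewrite (fsbigD1 z)//=.
by rewrite addn_gt0 muln_gt0 lt0n axz /chi asboolT.
Qed.

Lemma rd_mulrn RD a n : rank_distribution RD -> RD a -> RD (fun x y => (n.+1 * a x y)%N).
Proof.
move=> rd Ra; elim: n => [|n IH].
  by move: Ra; congr RD; apply/funext => x; apply/funext => y; rewrite mul1n.
exact: rd_add rd _ _ Ra IH.
Qed.

(** Each row on which [a] is nonzero contains a point of the support of [b], at
    bounded distance from every point of the support of [a] in that row; so [b E]
    is at least 1 on the support of [a] for a suitable entourage [E], and [a] is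
    dominated by a multiple of [b E]. *)
Lemma Rmin_sub RD U : rank_distribution RD -> open_of RD = U -> Rmin U `<=` RD.
Proof.
move=> rd RU a [[ra aU] [N aN]].
have [b Rb ab] : exists2 b, RD b & fst @` supp a `<=` fst @` supp b.
  by apply: rank_cover => //; rewrite RU -range_closureE.
have [ra' arP] := ra; have [rb' brP] := rd_rank rd Rb.
pose E : set (X * X) := [set p | mdist p.1 p.2 <= rb' + ra'].
have cE : controlled E by exists (rb' + ra').
apply: (rd_le rd ra (rd_mulrn N rd (rd_ract rd Rb cE))) => x y.
have [->//|axy] := eqVneq (a x y) 0%N.
have [[x' z] /= bxz xx'] : (fst @` supp b) x by apply: ab; exists (x, y).
rewrite xx' in bxz.
have : (0 < E_mulr b E x y)%N.
  apply: (@E_mulr_gt0 _ _ _ _ z) => //; first exact: rd_rank rd _ Rb.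
  rewrite /E/= (le_trans (metric_triangle z x y))// lerD//; last exact: arP.
  by rewrite metric_sym; exact: brP.
by move=> h; rewrite (leq_trans (aN x y))// (leq_trans (leqnSn N))// leq_pmulr.
Qed.

Lemma finite_supp_bounded a : finite_set (supp a) -> exists N, forall x y, (a x y <= N)%N.
Proof.
move=> fa; exists (\sum_(p <- fset_set (supp a)) a p.1 p.2)%N => x y.
have [->//|axy] := eqVneq (a x y) 0%N.
rewrite (big_fsetD1 (x, y)) ?leq_addr//= in_fset_set// inE//.
Qed.

(** If [U] contains a non-principal ultrafilter, it contains [bbase A] for some
    infinite [A], and the function with value [(e x).+1] at [(x, x)] for [x] in
    [A], where [e] enumerates [X], is unbounded. Conversely, if [U] is the set of
    principal ultrafilters, the rank functions of [Rmax U] have finite support.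
    Invariance is used to see that [U] contains every principal ultrafilter as
    soon as it contains one: all pairs of points belong to the groupoid. *)
Lemma Rmin_eq_Rmax U : U !=set0 -> invariant_set U -> open U ->
  Rmin U = Rmax U <-> U = range (@principal X).
Proof.
move=> U0 Uinv Uo; split=> [mm|UX]; last first.
  apply/seteqP; split => [a []//|a [ra aU]]; split => //.
  apply: finite_supp_bounded; have [r ar] := ra.
  have fA : finite_set (fst @` supp a).
    by apply: finite_bbase; rewrite -range_closureE -UX.
  apply: (@sub_finite_set _ _ (\bigcup_(x in fst @` supp a) ((pair x) @` [set y | mdist x y <= r]))).
    by move=> [x y] axy; exists x; [exists (x, y)|exists y => //=; exact: ar].
  by apply: bigcup_finite => // x _; exact/finite_image/finite_cball.
apply/seteqP; split => [F UF|]; last first.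
  have [x0 Ux0] : exists x0, U (principal x0).
    by have [F [UF [x _ xF]]] := @dense_principal X U U0 Uo; exists x; rewrite xF.
  move=> _ [x _ <-]; have := Uinv (principal (x, x0)).
  rewrite /gsource /grange !beta_map_principal; apply => //.
  exists (mdist x x0) => /=; first exact: mdist_ge0.
  by apply: subset_closure; exists (x, x0) => //=; rewrite /E_ /=.
have [A FA AU] : exists2 A, F A & bbase A `<=` U by apply/nbhs_betaP/open_nbhs_nbhs.
have [e e_inj] := countable_bounded_geometry.
pose a x y := if (x == y) && (x \in A) then (e x).+1 else 0%N.
have sa : supp a = (fun x => (x, x)) @` A.
  apply/seteqP; split => [[x y]|_ [x Ax <-]]; rewrite /supp /a /=.
    by case: ifP => // /andP[/eqP<- /set_mem Ax] _; exists x.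
  by rewrite eqxx mem_set.
have sA : fst @` supp a = A.
  rewrite sa; apply/seteqP; split => [_ [_ [x Ax <-] <-]//|x Ax].
  by exists (x, x) => //; exists x.
have : Rmax U a.
  split; last by rewrite range_closureE sA.
  exists 0 => x y; rewrite sa => -[z _ [<- <-]]; by rewrite mdistxx.
rewrite -mm => -[_ [N aN]].
have fA : finite_set A.
  apply: (@sub_finite_set _ _ (e @^-1` `I_N)).
    by move=> x Ax; have := aN x x; rewrite /a eqxx mem_set.
  by apply: finite_preimage => // x y _ _; exact: e_inj.
(* [A] being finite, [bbase A] is the finite, hence closed, set of principal
   ultrafilters at the points of [A], to which [F] belongs. *)
have : closed (principal @` A).
  exact: compact_closed (beta_hausdorff (T := X)) (finite_compact (finite_image _ fA)).
move=> /closure_id; rewrite closure_principal => pA.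
have : bbase A F by [].
by rewrite -pA => -[x _ <-]; exists x.
Qed.

End Coarse.

(** * Approximation inside an ideal *)

Section Main.
Context {R : realType} {X : metricType R} {H : completeNormedModType R[i]}.
Implicit Types (S T Z : l2 X H -> l2 X H) (a : X -> H -> H).

Lemma entry_diag C a x y h : 0 <= C -> block_bound C a ->
  entry (diag a) x y h = if x == y then a y h else 0.
Proof. by move=> C0 aC; rewrite /entry (diag_delta _ _ C0 aC). Qed.

Lemma diag_algRoe C a : 0 <= C -> block_bound C a ->
  (forall x, compact_op (a x)) -> algRoe (diag a).
Proof.
move=> C0 aC ac; split; first exact: diag_bounded C0 aC.
  move=> x y; rewrite (_ : entry _ x y = if x == y then a y else 0).
    by case: ifP => _; [exact: ac|exact: compact_op0].
  by apply/funext => h; rewrite (entry_diag _ _ _ C0 aC); case: ifP.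
exists 0 => x y; rewrite /opsupp /= => xy; case: (eqVneq x y) => [->|nxy].
  by rewrite mdistxx.
case: xy; apply/funext => h.
by rewrite (entry_diag _ _ _ C0 aC) (negbTE nxy).
Qed.

Lemma algRoe_Roe T : algRoe T -> Roe T.
Proof.
move=> aT; split; first by case: aT.
move=> e e0; exists T; split => //; apply: le_lt_trans e0.
rewrite -[leRHS]sqrtr0; apply: opnorm_le => // f.
have -> : (T - T) f = 0 by exact: (subrr (T f)).
by rewrite mul0e sqsumE l2norm0 expr0n.
Qed.

Lemma linear_sum_diag (J : finType) (C1 C2 : R) (a b : J -> X -> H -> H) Z :
  0 <= C1 -> 0 <= C2 -> linear Z ->
  (forall c, block_bound C1 (a c)) -> (forall c, block_bound C2 (b c)) ->
  linear (\sum_c (diag (a c) \o Z \o diag (b c))).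
Proof.
move=> C10 C20 lZ aC bC; elim/big_ind: _ => [|F G lF lG|c _] k f g.
- by rewrite /= scaler0 addr0.
- have FG h : (F + G) h = F h + G h by [].
  by rewrite !FG lF lG scalerDr addrACA.
by rewrite /= (diag_linear C20 (bC c)) lZ (diag_linear C10 (aC c)).
Qed.

(** Used when [P x y] has at most one solution [y] for each [x]: [a x] is then the
    block [A x y] of the partner [y] of [x], and 0 for a point without partner. *)
Lemma pick_family (A : X -> X -> H -> H) (P : X -> X -> Prop) :
  exists a, forall x, (exists2 y, P x y & a x = A x y) \/
                      ((forall y, ~ P x y) /\ a x = 0).
Proof.
suff /choice[a aP] x : exists ax, (exists2 y, P x y & ax = A x y) \/
                      ((forall y, ~ P x y) /\ ax = 0) by exists a.
have [[y Pxy]|nP] := pselect (exists y, P x y).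
  by exists (A x y); left; exists y.
by exists 0; right; split => // y Pxy; apply: nP; exists y.
Qed.

Variable dot : {dot H for (@Num.conj R[i])}.
Hypothesis dot_norm : forall h : H, `|h| ^+ 2 = dot h h.
Hypothesis bgX : bounded_geometry X.

(** The operator [sum_c A_c S B_c] described at the beginning, with an estimate
    of its distance to [T]. *)
Lemma ideal_approx I T S eps : roe_ideal I -> algRoe T ->
  (forall x y, finite_rank (entry T x y)) -> I S -> 0 < eps ->
  RANK (entry T) = RANK (trunc_mx dot eps S) ->
  forall e : R, 0 < e -> exists S', I S' /\ opnorm (T - S') < e.
Proof.
move=> Iid [bT _ [r rT]] fT IS eps0 TS e e0.
have [lT _] := bT; have [D D0 TD] := bounded_op_opbound bT.
have [bS Sclos] : Roe S by exact: ri_sub Iid _ IS.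
set M := Num.sqrt D.
have M0 : 0 <= M by exact: sqrtr_ge0.
have TM x y h : hnorm (entry T x y h) <= M * hnorm h.
  rewrite -(@ler_pXn2r _ 2) ?nnegrE ?mulr_ge0 ?hnorm_ge0//.
  by rewrite exprMn sqr_sqrtr//; exact: entry_hnorm.
have epsV0 : 0 <= eps^-1 by rewrite invr_ge0 ltW.
have /choice[AB ABP] (p : X * X) : exists AB : (H -> H) * (H -> H),
    [/\ compact_op AB.1, compact_op AB.2,
        forall h, hnorm (AB.1 h) <= eps^-1 * hnorm h,
        forall h, hnorm (AB.2 h) <= hnorm (entry T p.1 p.2 h) &
        forall h, entry T p.1 p.2 h = AB.1 (entry S p.1 p.2 (AB.2 h))].
  have rk : op_rank (entry T p.1 p.2) = op_rank (eps_trunc dot eps (entry S p.1 p.2)).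
    exact: (congr1 (fun F => F p.1 p.2) TS).
  have [A [B [cA cB An Bn AE]]] := rank_factor dot_norm eps0
    (entry_linear p.1 p.2 bS.1) (entry_linear p.1 p.2 lT) (TM p.1 p.2) (fT p.1 p.2) rk.
  by exists (A, B).
pose A x y := (AB (x, y)).1; pose B x y := (AB (x, y)).2.
have lA x y : linear (A x y) by have [[]] := ABP (x, y).
have lB x y : linear (B x y) by have [_ []] := ABP (x, y).
have [K KP] := card_cball bgX r.
have q0 : 0 <= K%:R * eps^-1 * M by rewrite !mulr_ge0.
(* Both error terms will be bounded by multiples of [d]. *)
have [d d0 dE] : exists2 d, 0 < d & 2 * (K%:R * eps^-1 * M) * d < e.
  exists (e / (2 * (K%:R * eps^-1 * M) + 1)).
    by rewrite divr_gt0// ltr_wpDl// mulr_ge0.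
  move: (K%:R * eps^-1 * M) q0 => q q0.
  rewrite mulrA ltr_pdivrMr ?ltr_wpDl ?mulr_ge0//.
  by rewrite mulrC ltr_pM2l// ltrDl.
have [S' [[bS' _ [L SL]] dS]] := Sclos d d0.
have bZ : bounded_op (S - S') by exact: bounded_opB.
have Zd : opbound (d ^+ 2) (S - S') by exact: opbound_opnorm.
(* Points of the same colour will be shown equal by bounding their distance:
   by [|L| + |r|] in [off], and by [|r| + |r|] in [selr] and [sell]. *)
have [N [f fP]] := coloring bgX (`|L| + `|r| + `|r|).
pose sel (c : 'I_N * 'I_N) x y := [/\ mdist x y <= r, f x = c.1 & f y = c.2].
have /choice[a aP] c := pick_family A (sel c).
have /choice[b bP] c := pick_family (fun y x => B x y) (fun y x => sel c x y).
have aC c : block_bound eps^-1 (a c).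
  split=> x; have [[y _ ->]|[_ ->]] := aP c x.
  - exact: lA.
  - by move=> k h h'; rewrite /= scaler0 addr0.
  - by have [_ _] := ABP (x, y).
  - by move=> h; rewrite /= hnorm0 mulr_ge0 ?hnorm_ge0.
have bC c : block_bound M (b c).
  split=> y; have [[x _ ->]|[_ ->]] := bP c y.
  - exact: lB.
  - by move=> k h h'; rewrite /= scaler0 addr0.
  - by move=> h; have [_ _ _ Bn _] := ABP (x, y); apply: le_trans (Bn h) (TM x y h).
  - by move=> h; rewrite /= hnorm0 mulr_ge0 ?hnorm_ge0.
have ac c : algRoe (diag (a c)).
  apply: (diag_algRoe epsV0 (aC c)) => x; have [[y _ ->]|[_ ->]] := aP c x.
    by have [] := ABP (x, y).
  exact: compact_op0.
have bc c : algRoe (diag (b c)).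
  apply: (diag_algRoe M0 (bC c)) => y; have [[x _ ->]|[_ ->]] := bP c y.
    by have [] := ABP (x, y).
  exact: compact_op0.
pose D1 x := [set c in [seq (f x, f y) | y <- cball r x]]%SET.
pose D2 y := [set c in [seq (f x, f y) | x <- cball r y]]%SET.
have D1K x : (#|D1 x| <= K)%N.
  by rewrite cardsE (leq_trans (card_size _))// size_map.
have D2K x : (#|D2 x| <= K)%N.
  by rewrite cardsE (leq_trans (card_size _))// size_map.
have aD c x : c \notin D1 x -> a c x = 0.
  move=> cD; have [[y [xy fx fy] _]|[]//] := aP c x; exfalso; move/negP: cD; apply.
  rewrite inE; apply/mapP; exists y; first by rewrite (in_cball bgX).
  by rewrite fx fy; case: (c).
have bD c y : c \notin D2 y -> b c y = 0.
  move=> cD; have [[x [xy fx fy] _]|[]//] := bP c y; exfalso; move/negP: cD; apply.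
  rewrite inE; apply/mapP; exists x; first by rewrite (in_cball bgX) metric_sym.
  by rewrite fx fy; case: (c).
pose F Z := \sum_c (diag (a c) \o Z \o diag (b c)).
exists (F S); split.
  apply: (big_ind I); [exact: ri_0|by move=> ? ?; apply: ri_add Iid _ _|].
  move=> c _; apply: (ri_mulr Iid (algRoe_Roe (bc c))).
  exact: (ri_mull Iid (algRoe_Roe (ac c)) IS).
have Fbound Z C : 0 <= C -> opbound C Z ->
    opbound (K%:R * eps^-1 ^+ 2 * (C * (K%:R * M ^+ 2))) (F Z).
  by move=> C0 ZC; exact: (opbound_sum_diag epsV0 M0 C0 D1K D2K aD bD aC bC ZC).
have FE Z g : F Z g = \sum_c diag (a c) (Z (diag (b c) g)) by rewrite /F fct_sumE.
have FB : F (S - S') = F S - F S'.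
  apply/funext => g; rewrite -[RHS]/(F S g - F S' g) !FE -sumrB.
  apply: eq_bigr => c _; have [da daE] := linear_pack (diag_linear epsV0 (aC c)).
  by rewrite daE -linearB.
have bFS' : bounded_op (F S').
  have [C C0 SC] := bounded_op_opbound bS'.
  apply: opbound_bounded_op (Fbound _ _ C0 SC).
    exact: (linear_sum_diag epsV0 M0 bS'.1).
  by rewrite !mulr_ge0 ?sqr_ge0.
have selr c x y y' : sel c x y -> sel c x y' -> y = y'.
  move=> [xy _ fy] [xy' _ fy']; apply: fP; last by rewrite fy fy'.
  rewrite (le_trans (metric_triangle y x y'))// (metric_sym y x) -addrA.
  by rewrite ler_wpDl// lerD// (le_trans _ (ler_norm r)).
have sell c y x x' : sel c x y -> sel c x' y -> x = x'.
  move=> [xy fx _] [xy' fx' _]; apply: fP; last by rewrite fx fx'.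
  rewrite (le_trans (metric_triangle x y x'))// (metric_sym y x') -addrA.
  by rewrite ler_wpDl// lerD// (le_trans _ (ler_norm r)).
(* If neither block vanishes, [x] has a partner [y'] and [y] has a partner [x'].
   An entry of [S'] at [(x, y)] forces [y] and [y'] to be close; they have the same
   colour, hence are equal. *)
have off c x y h : ~ sel c x y -> a c x (entry S' x y (b c y h)) = 0.
  move=> nsel; have [[y' sxy' ->]|[_ ->]//] := aP c x.
  have [Axy AxyE] := linear_pack (lA x y').
  have [xyL|nxyL] := pselect (opsupp S' (x, y)); last first.
    have -> : entry S' x y = 0 by apply: contrapT.
    by rewrite AxyE linear0.
  have [[x' sx'y ->]|[_ ->]] := bP c y; last first.
    have [Sxy SxyE] := linear_pack (entry_linear x y bS'.1).
    by rewrite SxyE linear0 AxyE linear0.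
  exfalso; apply: nsel; suff -> : y = y' by [].
  have [[xy' fx fy'] [_ _ fy]] := (sxy', sx'y).
  apply: fP; last by rewrite fy fy'.
  rewrite (le_trans (metric_triangle y x y'))// (metric_sym y x).
  rewrite lerD ?(le_trans xy' (ler_norm r))// ler_wpDr//.
  exact: le_trans (SL x y xyL) (ler_norm L).
have VE x y h : entry (T - F S') x y h =
    entry T x y h - \sum_c a c x (entry S' x y (b c y h)).
  rewrite /entry -[(T - F S') _]/(T _ - F S' _) l2valB FE l2val_sum.
  congr (_ - _); apply: eq_bigr => c _.
  by rewrite (diagE _ _ epsV0 (aC c)) (diag_delta _ _ M0 (bC c)).
have Vbound : opbound ((K%:R * (eps^-1 * d * M)) ^+ 2) (T - F S').
  apply: (schur_test (B := cball r)) => //.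
  - exact: bounded_opB bT bFS'.
  - by rewrite !mulr_ge0// ltW.
  - by move=> x y; exact: cball_sym.
  - move=> x y; rewrite (in_cball bgX) => xy; apply/funext => h; rewrite VE.
    rewrite big1 => [|c _]; last by apply: off => -[/(negP xy)].
    rewrite subr0; suff -> : entry T x y = 0 by [].
    by apply: contrapT => /(rT x y) /(negP xy).
  move=> x y h; have [xy|nxy] := boolP (mdist x y <= r); last first.
    rewrite VE big1 => [|c _]; last by apply: off => -[/(negP nxy)].
    rewrite (_ : entry T x y = 0) ?subr0 ?hnorm0 ?mulr_ge0 ?hnorm_ge0// ?(ltW d0)//.
    by apply: contrapT => /(rT x y) /(negP nxy).
  have [_ _ An Bn TE] := ABP (x, y).
  have sxy : sel (f x, f y) x y by [].
  (* Only the pair of colours of [(x, y)] contributes at [(x, y)]. *)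
  rewrite VE (bigD1 (f x, f y))//= [X in _ - (_ + X)]big1 ?addr0 => [|c cf]; last first.
    apply: off => -[_ fx fy]; move/eqP: cf; apply; case: c fx fy => c1 c2 /= -> ->; by [].
  have -> : a (f x, f y) x = A x y.
    have [[y' sxy' ->]|[/(_ y)]//] := aP (f x, f y) x.
    by rewrite (selr _ _ _ _ sxy sxy').
  have -> : b (f x, f y) y = B x y.
    have [[x' sxy' ->]|[/(_ x)]//] := bP (f x, f y) y.
    by rewrite (sell _ _ _ _ sxy sxy').
  rewrite [entry T x y h](TE h).
  have [Axy AxyE] := linear_pack (lA x y).
  rewrite -/(A x y) AxyE -linearB -AxyE.
  rewrite -!mulrA; apply: (le_trans (An _)); rewrite ler_wpM2l//.
  apply: (le_trans _ (ler_wpM2l (ltW d0) (le_trans (Bn h) (TM x y h)))).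
  rewrite -(@ler_pXn2r _ 2) ?nnegrE ?mulr_ge0 ?hnorm_ge0 ?(ltW d0)//.
  by rewrite exprMn; exact: entry_hnorm Zd.
have -> : T - F S = (T - F S') + - F (S - S') by rewrite FB opprB addrA subrK.
have C0 : 0 <= 2 * (K%:R * (eps^-1 * d * M)) ^+ 2 +
    2 * (K%:R * eps^-1 ^+ 2 * (d ^+ 2 * (K%:R * M ^+ 2))).
  by rewrite addr_ge0// !mulr_ge0// ?sqr_ge0// ltW.
have := opnorm_le C0 (opboundD Vbound (opboundN (Fbound _ _ (sqr_ge0 d) Zd))).
move=> /le_lt_trans; apply.
(* Both squared error bounds are equal to [(K eps^-1 M d)^2]. *)
rewrite (_ : _ + _ = (2 * (K%:R * eps^-1 * M) * d) ^+ 2); last by ring.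
by rewrite sqrtr_sqr ger0_norm// !mulr_ge0// ltW.
Qed.
End Main.

Theorem theoremB (R : realType) (X : metricType R)
    (X_discrete : forall x : X, open [set x])
    (X_bounded_geometry : bounded_geometry X)
    (H : completeNormedModType R[i]) (dot : {dot H for (@Num.conj R[i])})
    (dot_norm : forall h : H, `|h| ^+ 2 = dot h h)
    (H_separable : separable_space H) (H_infinite_dim : infinite_dim H) :
  (forall (RD : set (X -> X -> nat)) (I : set (l2 X H -> l2 X H)),
      rank_distribution RD ->
      roe_ideal I -> nonzero_ideal I -> rank_distr_of dot I = RD ->
      geometric_ideal RD `<=` I /\ I `<=` ghostly_ideal dot RD)
  /\
  (forall U : set (beta X),
      U !=set0 -> invariant_set U -> open U ->
      (forall RD : set (X -> X -> nat),
          rank_distribution RD -> open_of RD = U ->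
          Rmin U `<=` RD /\ RD `<=` Rmax U)
      /\ (Rmin U = Rmax U <-> U = range (@principal X))).
Proof.
split.
  move=> RD I rd Iid _ RDI; split=> [T [bT Tcl]|T IT]; last first.
    by split=> [|eps eps0]; [exact: ri_sub Iid _ IT|rewrite -RDI; exists T, eps].
  apply: (ri_closed Iid); split=> // e e0.
  have [S [[aS fS RS] TS]] := Tcl e e0; exists S; split=> //.
  apply: (ri_closed Iid); split=> [|e' e'0]; first by case: aS.
  move: RS; rewrite -RDI => -[S0 [eps [IS0 eps0 RS]]].
  exact: (ideal_approx dot_norm X_bounded_geometry Iid aS fS IS0 eps0 RS).
move=> U U0 Uinv Uo; split; last exact: Rmin_eq_Rmax.
move=> RD rd RU; split; first exact: Rmin_sub.
move=> a Ra; split; first exact: rd_rank rd _ Ra.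
by move=> F aF; rewrite -RU; exists a.
Qed.
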